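(* Let $d=2$. A lattice-invariant valuation $\varphi:\mathcal{P}(\mathbb{Z}^2)\to\mathbb{R}$ is monotone (i.e. $\varphi(Q)\le\varphi(P)$ for all lattice polytopes $Q\subseteq P$) if and only if $\varphi=a\,\chi+b'\,(b+\mathrm{vol}_2)+c\,\mathrm{vol}_2$ for some $a,b',c\ge0$. In particular, the cone of monotone lattice-invariant valuations $\mathcal{P}(\mathbb{Z}^2)\to\mathbb{R}$ is simplicial and generated by $\chi$, $b+\mathrm{vol}_2$ and $\mathrm{vol}_2$.
   Context: $\mathcal{P}(\mathbb{Z}^2)$ is the set of lattice polygons/polytopes in $\mathbb{R}^2$ (including $\emptyset$). A valuation satisfies $\varphi(\emptyset)=0$ and $\varphi(P\cup Q)+\varphi(P\cap Q)=\varphi(P)+\varphi(Q)$ whenever $P,Q,P\cup Q,P\cap Q$ are lattice polytopes; lattice-invariant means $\varphi(T(P))=\varphi(P)$ for every affine $T$ with $T(\mathbb{Z}^2)=\mathbb{Z}^2$. $\chi$ is the Euler characteristic ($1$ on nonempty polytopes, $0$ on $\emptyset$), $\mathrm{vol}_2$ is area, and $b(P):=|P\cap\mathbb{Z}^2|-\mathrm{vol}_2(P)-\chi(P)$ (so that $|nP\cap\mathbb{Z}^2|=\mathrm{vol}_2(P)n^2+b(P)n+\chi(P)$). *)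

(* Defs.v *)
From HB Require Import structures.
From mathcomp Require Import all_boot all_order all_algebra.
From mathcomp Require Import finmap.
From mathcomp Require Import all_classical all_reals all_analysis.

Set Implicit Arguments.
Unset Strict Implicit.
Unset Printing Implicit Defensive.

Import Order.TTheory GRing.Theory Num.Theory.
Import numFieldNormedType.Exports.

Local Open Scope classical_set_scope.
Local Open Scope ring_scope.

Section LatticePolytopes.
Context {R : realType}.

Definition Z2 : set (R * R) :=
  [set x | x.1 \is a Num.int /\ x.2 \is a Num.int].

Definition convex_hull (A : set (R * R)) : set (R * R) :=
  smallest (fun C : set (convex_lmodType (R * R)%type) => convex_set C) A.

(* The vertex set may be empty, so set0 is a lattice polytope. *)
Definition is_lattice_polytope (P : set (R * R)) : Prop :=
  exists V : set (R * R), [/\ finite_set V, V `<=` Z2 & P = convex_hull V].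

End LatticePolytopes.

Record latticePolytope (R : realType) := LatticePolytope {
  lpset :> set (R * R);
  lpsetP : is_lattice_polytope lpset }.

Section Valuations.
Context {R : realType}.
Implicit Types (phi : latticePolytope R -> R) (P Q U I : latticePolytope R).

Definition valuation phi : Prop :=
  (forall P, lpset P = set0 -> phi P = 0) /\
  (forall P Q U I, lpset U = P `|` Q -> lpset I = P `&` Q ->
    phi U + phi I = phi P + phi Q).

Definition affine_map (T : R * R -> R * R) : Prop :=
  exists (L : {linear (R * R)%type -> (R * R)%type}) (t : R * R),
    forall x, T x = L x + t.

Definition lattice_invariant phi : Prop :=
  forall T : R * R -> R * R, affine_map T -> T @` Z2 = Z2 ->
  forall P Q, lpset Q = T @` P -> phi Q = phi P.

Definition monotone_valuation phi : Prop :=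
  forall P Q, lpset Q `<=` lpset P -> phi Q <= phi P.

Definition euler_char (P : latticePolytope R) : R := (lpset P != set0)%:R.

Definition vol2 (P : latticePolytope R) : R :=
  fine ((@lebesgue_measure R \x @lebesgue_measure R)%E (lpset P)).

(* [fset_set] is [fset0] on infinite sets, but the lattice points of a
   polytope are finite in number. *)
Definition lattice_count (P : latticePolytope R) : R :=
  #|` fset_set (lpset P `&` Z2)|%:R.

Definition b_val (P : latticePolytope R) : R :=
  lattice_count P - vol2 P - euler_char P.

End Valuations.

Section Cones.
Context {R : realType} {E : lmodType R}.

Definition lin_independent n (g : n.-tuple E) : Prop :=
  forall c : 'I_n -> R,
    \sum_(i < n) c i *: tnth g i = 0 -> forall i, c i = 0.

Definition conic_hull n (g : n.-tuple E) : set E :=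
  [set v | exists2 c : 'I_n -> R,
     (forall i, 0 <= c i) & v = \sum_(i < n) c i *: tnth g i].

Definition simplicial_cone_generated_by n (C : set E) (g : n.-tuple E) : Prop :=
  lin_independent g /\ C = conic_hull g.

End Cones.

(* Main.v *)
Require Import Defs.
From HB Require Import structures.
From mathcomp Require Import all_boot all_order all_algebra.
From mathcomp Require Import finmap ring lra zify.
From mathcomp Require Import all_classical all_reals all_analysis measurable_realfun.
Import Order.TTheory GRing.Theory Num.Theory.
Import numFieldNormedType.Exports.
Local Open Scope classical_set_scope.
Local Open Scope ring_scope.

Set Implicit Arguments.
Unset Strict Implicit.
Unset Printing Implicit Defensive.

(* A lattice-invariant valuation that vanishes on a point, a primitive segment
   and a unimodular triangle is zero.  Cutting off the triangle spanned by the
   lexicographically least vertex and its two angular neighbours reduces any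
   polygon to triangles.  Writing G(u, w) for the value on the triangle with
   vertices 0, u, w, the two diagonals of a parallelogram give
   G(u, w) = G(u, u + w), so G is invariant under column operations, and the
   Euclidean algorithm with G(u, k w) = k G(u, w) brings G to G(e1, e2) = 0.
   Hence a valuation is determined by its values at these three simplices.
   When it is monotone, comparing the segment [0, n e1] with the triangle
   0, n e1, e2 gives b' + n c / 2 >= 0 for all n, that is c >= 0. *)

(** * Convex hulls of lattice points *)

(** The valuation identity concerns two pieces whose union and intersection are again polytopes, so
    inclusion-exclusion over a whole triangulation is not directly at hand. Every decomposition is
    therefore a single cut along a chord with a triangle on one side, and the geometric core is that
    the two pieces have a convex union. The triangles cut off are arbitrary, not unimodular: their
    values are computed algebraically through G, without looking at the lattice points inside.
    Vanishing is applied to the difference of [phi] and a candidate combination, whose coefficients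
    come from a triangular system. The generator is b + vol_2 and not b because the area cancels in
    it: it is the number of lattice points minus chi. By contrast b is not monotone: it drops from n
    on the segment [0, n e1] to n/2 + 1 on the triangle 0, n e1, e2 as soon as n > 2. *)

Section ConvexHull.
Context {R : realType}.
Implicit Types (C : set (R * R)) (s : seq (int * int)) (p u v w : int * int).

(** Convexity in coordinates and with a plain real parameter, so that [ring], [lra] and [nra]
    apply. *)
Definition pconvex C : Prop := forall (x y : R * R) (t : R), 0 <= t -> t <= 1 ->
  C x -> C y -> C (t * x.1 + (1 - t) * y.1, t * x.2 + (1 - t) * y.2).

Lemma convex_setE C : convex_set (C : set (convex_lmodType (R * R)%type)) <-> pconvex C.
Proof.
split=> [Cc x y t t0 t1 /mem_set Cx /mem_set Cy|Cc x y l /set_mem Cx /set_mem Cy].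
  have t01 : (0 <= t <= 1) by rewrite t0.
  exact: set_mem (Cc x y (Itv01 t0 t1) Cx Cy).
apply: mem_set; exact: (Cc x y l%:num (ge0 l) (le1 l) Cx Cy).
Qed.

Definition emb p : R * R := (p.1%:~R, p.2%:~R).

Lemma emb_inj : injective emb.
Proof.
move=> [a b] [c d] [] /eqP; rewrite eqr_int => /eqP -> /eqP.
by rewrite eqr_int => /eqP ->.
Qed.

Lemma Z2_emb (x : R * R) : Z2 x <-> exists p, x = emb p.
Proof.
split=> [[/intrP[a xa] /intrP[b xb]]|[p ->]]; last by split; exact: intr_int.
by exists (a, b); rewrite /emb /= -xa -xb; case: x {xa xb}.
Qed.

Definition hull s : set (R * R) := convex_hull [set emb p | p in [set` s]].

Lemma hull_sub s C : pconvex C -> (forall p, p \in s -> C (emb p)) -> hull s `<=` C.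
Proof.
move=> Cc sC; apply: smallest_sub; first exact/convex_setE.
by move=> _ [p ps <-]; apply: sC.
Qed.

Lemma mem_hull s p : p \in s -> hull s (emb p).
Proof. by move=> ps; apply: sub_gen_smallest; exists p. Qed.

Lemma hull_convex s : pconvex (hull s).
Proof.
move=> x y t t0 t1 hx hy C [Cc sC]; have /convex_setE Cc' := Cc.
by apply: Cc' => //; [apply: hx|apply: hy].
Qed.

Lemma sub_hull s1 s2 : (forall p, p \in s1 -> hull s2 (emb p)) -> hull s1 `<=` hull s2.
Proof. by move=> h; apply: hull_sub => //; exact: hull_convex. Qed.

Lemma hull_mono s1 s2 : {subset s1 <= s2} -> hull s1 `<=` hull s2.
Proof. by move=> h; apply: sub_hull => p /h; exact: mem_hull. Qed.

Lemma eq_hull s1 s2 : s1 =i s2 -> hull s1 = hull s2.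
Proof. by move=> h; apply/seteqP; split; apply: hull_mono => p; rewrite h. Qed.

Lemma hull_lattice s : is_lattice_polytope (hull s).
Proof.
exists [set emb p | p in [set` s]]; split => //.
  exact/finite_image/finite_seq.
by move=> _ [p _ <-]; apply/Z2_emb; exists p.
Qed.

Definition poly s : latticePolytope R := LatticePolytope (hull_lattice s).

Lemma lpset_inj : injective (@lpset R).
Proof.
by move=> [P hP] [Q hQ] /= PQ; subst Q; congr LatticePolytope; exact: Prop_irrelevance.
Qed.

(** Passes from real to integer vertices, where orientation tests are decidable and within reach of
    [lia]. *)
Lemma polyP (P : latticePolytope R) : exists s, P = poly s.
Proof.
case: (lpsetP P) => V [/finite_seqP[q Vq] VZ PV].
have [f fK] : exists f : R * R -> int * int, forall x, Z2 x -> emb (f x) = x.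
  have /choice[f fK] : forall x : R * R, exists p, Z2 x -> emb p = x.
    move=> x; have [/Z2_emb[p ->]|nx] := pselect (Z2 x); first by exists p.
    by exists (0, 0).
  by exists f.
exists (map f q); apply: lpset_inj; rewrite PV /= /hull; congr convex_hull.
rewrite Vq in VZ *; apply/seteqP; split=> [x /= xq|_ [p /= /mapP[x xq ->] <-]].
  by exists (f x); [apply: map_f|apply/fK/VZ].
by rewrite fK//; exact: VZ.
Qed.

Lemma hull0 : hull [::] = set0.
Proof. by rewrite -subset0; apply: hull_sub. Qed.

Lemma hull1 p : hull [:: p] = [set emb p].
Proof.
apply/seteqP; split=> [|_ ->]; last by apply: mem_hull; rewrite mem_head.
apply: hull_sub => [x y t _ _ -> ->|q]; last by rewrite inE => /eqP ->.
by rewrite /emb /=; congr pair; ring.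
Qed.

Lemma hull2 u w x : hull [:: u; w] x <-> exists2 t : R, 0 <= t <= 1 &
  x = (t * (emb u).1 + (1 - t) * (emb w).1, t * (emb u).2 + (1 - t) * (emb w).2).
Proof.
split=> [|[t /andP[t0 t1] ->]]; last first.
  by apply: hull_convex => //; apply: mem_hull; rewrite !inE eqxx ?orbT.
move: x; apply: hull_sub => [x y t t0 t1 [a a01 ->] [b b01 ->]|q] /=.
  exists (t * a + (1 - t) * b); first by apply/andP; split; nra.
  by congr pair; ring.
rewrite !inE => /orP[]/eqP ->; [exists 1|exists 0]; rewrite ?lexx ?ler01//;
  by rewrite /emb /=; congr pair; ring.
Qed.

(** Twice the signed area of the triangle [u v x], positive when [x] is to the left of the line from
    [u] to [v]. The ring is arbitrary so that it serves integer vertices and real points alike. *)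
Definition det3 (T : comPzRingType) (u v x : T * T) : T :=
  (v.1 - u.1) * (x.2 - u.2) - (v.2 - u.2) * (x.1 - u.1).

Lemma det3_cycle (T : comPzRingType) (u v w : T * T) : det3 v w u = det3 u v w.
Proof. by rewrite /det3; ring. Qed.

Lemma det3_swap (T : comPzRingType) (u v w : T * T) : det3 v u w = - det3 u v w.
Proof. by rewrite /det3; ring. Qed.

Lemma det3_emb u v w : det3 (emb u) (emb v) (emb w) = (det3 u v w)%:~R.
Proof. by rewrite /det3 /emb /=; rewrite !(intrB, intrM). Qed.

Lemma convex_comb3 C (x y z : R * R) (a b c : R) : pconvex C -> C x -> C y -> C z ->
  0 <= a -> 0 <= b -> 0 <= c -> a + b + c = 1 ->
  C (a * x.1 + b * y.1 + c * z.1, a * x.2 + b * y.2 + c * z.2).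
Proof.
move=> Cc Cx Cy Cz a0 b0 c0 abc.
(* For [c = 1] the weight [a / (a + b)] of the inner combination would be 0 / 0. *)
have [c1|c1] := eqVneq c 1.
  have -> : a = 0 by lra.
  have -> : b = 0 by lra.
  by rewrite c1 !mul0r !mul1r !add0r; case: z Cz.
have ab0 : 0 < a + b by rewrite lt_neqAle; apply/andP; split; [apply/eqP; move/eqP: c1; lra|lra].
have tn : (a + b) != 0 by rewrite gt_eqF.
have -> : (a * x.1 + b * y.1 + c * z.1, a * x.2 + b * y.2 + c * z.2) =
  ((a + b) * (a / (a + b) * x.1 + (1 - a / (a + b)) * y.1) + (1 - (a + b)) * z.1,
   (a + b) * (a / (a + b) * x.2 + (1 - a / (a + b)) * y.2) + (1 - (a + b)) * z.2).
  by have -> : c = 1 - (a + b) by [lra]; congr pair; field.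
apply: (Cc (_, _) z) => //; first exact: ltW.
  by lra.
apply: Cc => //; first by rewrite divr_ge0// ltW.
by rewrite ler_pdivrMr// mul1r; lra.
Qed.

Lemma halfplane_convex (a b c : R) : pconvex [set x | 0 <= a * x.1 + b * x.2 + c].
Proof.
move=> x y t t0 t1 /= hx hy.
have -> : a * (t * x.1 + (1 - t) * y.1) + b * (t * x.2 + (1 - t) * y.2) + c =
  t * (a * x.1 + b * x.2 + c) + (1 - t) * (a * y.1 + b * y.2 + c) by ring.
by rewrite addr_ge0// mulr_ge0// subr_ge0.
Qed.

Lemma pconvexI (A B : set (R * R)) : pconvex A -> pconvex B -> pconvex (A `&` B).
Proof. by move=> hA hB x y t t0 t1 [? ?] [? ?]; split; [apply: hA|apply: hB]. Qed.

Definition left_side (u v : R * R) : set (R * R) := [set x | 0 <= det3 u v x].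

Lemma left_sideE (u v : R * R) : left_side u v =
  [set x | 0 <= (u.2 - v.2) * x.1 + (v.1 - u.1) * x.2 +
     ((v.2 - u.2) * u.1 - (v.1 - u.1) * u.2)].
Proof.
apply/seteqP; split=> x; rewrite /left_side /det3 /=; congr (is_true (0 <= _)); ring.
Qed.

Lemma left_side_convex (u v : R * R) : pconvex (left_side u v).
Proof. by rewrite left_sideE; exact: halfplane_convex. Qed.

(** Cramer's rule: barycentric coordinates are quotients of signed areas. Hence their signs decide
    membership in a triangle, as used in [hull3]. *)
Lemma det3_bary (u v w x : R * R) : det3 u v w != 0 ->
  let d := det3 u v w in
  x = (det3 v w x / d * u.1 + det3 w u x / d * v.1 + det3 u v x / d * w.1,
       det3 v w x / d * u.2 + det3 w u x / d * v.2 + det3 u v x / d * w.2).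
Proof.
move=> d0 d; rewrite /d; case: x => x y /=; move: d0; rewrite /det3 /= => d0.
by congr pair; field.
Qed.

Lemma det3_sum (u v w x : R * R) :
  det3 v w x + det3 w u x + det3 u v x = det3 u v w.
Proof. by rewrite /det3; ring. Qed.

Lemma hull3 u v w : 0 < det3 u v w ->
  hull [:: u; v; w] = left_side (emb u) (emb v) `&` left_side (emb v) (emb w)
    `&` left_side (emb w) (emb u).
Proof.
move=> d0.
have e0 : 0 < det3 (emb u) (emb v) (emb w) by rewrite det3_emb ltr0z.
apply/seteqP; split.
  apply: hull_sub.
    by do 2![apply: pconvexI; last exact: left_side_convex]; exact: left_side_convex.
  move=> p; rewrite !inE /left_side => /or3P[]/eqP -> /=; move: e0; rewrite /det3 => e0;
    repeat split; lra.
move=> x [[h1 h2] h3]; rewrite (det3_bary x (lt0r_neq0 e0)).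
rewrite /left_side /= in h1 h2 h3; apply: convex_comb3 => //.
- exact: hull_convex.
- by apply: mem_hull; rewrite !inE eqxx.
- by apply: mem_hull; rewrite !inE eqxx orbT.
- by apply: mem_hull; rewrite !inE eqxx !orbT.
- by rewrite divr_ge0// ltW.
- by rewrite divr_ge0// ltW.
- by rewrite divr_ge0// ltW.
- by rewrite -!mulrDl det3_sum divff// gt_eqF.
Qed.

(** The barycentric coordinate of [x] at [v] vanishes, so the other two are the weights of a point
    of the segment. *)
Lemma base_hull2 v u w x : 0 < det3 v u w -> left_side (emb v) (emb u) x ->
  left_side (emb w) (emb v) x -> det3 (emb u) (emb w) x = 0 -> hull [:: u; w] x.
Proof.
move=> d0 h1 h2 h3.
have e0 : 0 < det3 (emb v) (emb u) (emb w) by rewrite det3_emb ltr0z.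
rewrite (det3_bary x (lt0r_neq0 e0)) h3; have := det3_sum (emb v) (emb u) (emb w) x.
rewrite h3 add0r => hs; rewrite /left_side /= in h1 h2.
have hu : hull [:: u; w] (emb u) by apply: mem_hull; rewrite !inE eqxx.
have hw : hull [:: u; w] (emb w) by apply: mem_hull; rewrite !inE eqxx orbT.
have := hull_convex (t := det3 (emb w) (emb v) x / det3 (emb v) (emb u) (emb w)) _ _ hu hw.
have -> : 1 - det3 (emb w) (emb v) x / det3 (emb v) (emb u) (emb w) =
   det3 (emb v) (emb u) x / det3 (emb v) (emb u) (emb w).
  by rewrite -{1}(divff (lt0r_neq0 e0)) -mulrBl -hs addrAC subrr add0r.
rewrite !mul0r !add0r; apply; first by rewrite divr_ge0// ltW.
by rewrite ler_pdivrMr// mul1r -hs lerDl.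
Qed.

(** * Cutting off the corner at a vertex along a chord *)

Section Cut.
Variables (v u w : int * int) (V : seq (int * int)).
Hypotheses (d0 : 0 < det3 v u w) (uV : u \in V) (wV : w \in V).
(** [V] lies in the cone with apex [v] through [u] and [w], beyond the line [u w] as seen from
    [v]. *)
Hypothesis coneV : forall p, p \in V ->
  [/\ 0 <= det3 v u p, 0 <= det3 w v p & det3 u w p <= 0].

Let hullV_sub : hull V `<=` left_side (emb v) (emb u) `&` left_side (emb w) (emb v)
  `&` left_side (emb w) (emb u).
Proof.
apply: hull_sub.
  by do 2![apply: pconvexI; last exact: left_side_convex]; exact: left_side_convex.
move=> p /coneV[h1 h2 h3]; rewrite /left_side /= !det3_emb !ler0z; repeat split => //.
by move: h3; rewrite /det3; lia.
Qed.

(** The pieces are on opposite sides of the line [u w], so a common point is on it, and the cone at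
    [v] confines it to the segment. *)
Lemma cut_cap : hull V `&` hull [:: v; u; w] = hull [:: u; w].
Proof.
apply/seteqP; split=> [x [/hullV_sub[[h1 h2]]]|x hx].
  rewrite hull3// => h3 [[_ h4] _]; apply: base_hull2 d0 h1 h2 _.
  by apply/eqP; move: h3 h4; rewrite /left_side /= det3_swap => h3 h4; rewrite eq_le h4 andbT -oppr_ge0.
by split; move: hx; apply: hull_mono => p; rewrite !inE => /orP[]/eqP -> //; rewrite eqxx ?orbT.
Qed.

(** Only a segment from [x] in [hull V] to [y] in the triangle needs work. It stays in the cone at
    [v], so its points on the side of [v] are in the triangle. A point beyond the chord lies between
    [x] and the crossing with the chord, both in [hull V]. *)
Let cut_convex : pconvex (hull V `|` hull [:: v; u; w]).
Proof.
have cross x y t : 0 <= t -> t <= 1 -> hull V x -> hull [:: v; u; w] y ->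
    (hull V `|` hull [:: v; u; w]) (t * x.1 + (1 - t) * y.1, t * x.2 + (1 - t) * y.2).
  move=> t0 t1 Vx; rewrite hull3// => -[[y1 y2] y3].
  have [[x1 x2] x3] := hullV_sub Vx.
  set z := (t * x.1 + _, _).
  have z1 : left_side (emb v) (emb u) z by exact: left_side_convex.
  have z2 : left_side (emb w) (emb v) z by exact: left_side_convex.
  have [z3|z3] := leP 0 (det3 (emb u) (emb w) z); first by right.
  left.
  (* [r] is where the segment from [x] to [y] crosses the line [u w]. *)
  pose f := det3 (emb u) (emb w).
  have fz : f z = t * f x + (1 - t) * f y by rewrite /f /det3 /=; ring.
  have fx : f x <= 0 by move: x3; rewrite /left_side /= det3_swap oppr_ge0.
  have fy : 0 <= f y by [].
  have fz0 : f z < 0 by [].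
  have fxy : 0 < f y - f x by nra.
  pose m := f y / (f y - f x).
  have mfx : m * f x + (1 - m) * f y = 0 by rewrite /m; field; rewrite gt_eqF.
  have m0 : 0 <= m by rewrite /m divr_ge0// ltW.
  have m1 : m < 1.
    by rewrite /m ltr_pdivrMr// mul1r; nra.
  have mt : m <= t by nra.
  pose r : R * R := (m * x.1 + (1 - m) * y.1, m * x.2 + (1 - m) * y.2).
  have Vr : hull V r.
    have : hull [:: u; w] r.
      apply: base_hull2 d0 _ _ _; [exact: left_side_convex (ltW m1) _ _|exact: left_side_convex (ltW m1) _ _|].
      by rewrite -/f -mfx /r /f /det3 /=; ring.
    by apply: hull_mono => p; rewrite !inE => /orP[]/eqP ->.
  have m10 : 1 - m != 0 by rewrite subr_eq0 gt_eqF.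
  (* On the segment, [r] has parameter [m] and [x] has parameter 1; rescaling [m, 1] to [0, 1] gives
     the weight of [x]. *)
  have -> : z = ((t - m) / (1 - m) * x.1 + (1 - (t - m) / (1 - m)) * r.1,
                 (t - m) / (1 - m) * x.2 + (1 - (t - m) / (1 - m)) * r.2).
    by rewrite /z /r /=; congr pair; field.
  apply: hull_convex => //; first by rewrite divr_ge0// subr_ge0// ltW.
  by rewrite ler_pdivrMr ?subr_gt0// mul1r; lra.
move=> x y t t0 t1 [hx|hx] [hy|hy].
- by left; exact: hull_convex.
- exact: cross.
- have := cross y x (1 - t) _ _ hy hx; rewrite subKr ![(1 - t) * _ + _]addrC; apply; lra.
- by right; exact: hull_convex.
Qed.

(** By [cut_convex] the union is a convex set containing [v] and [V], hence their hull. *)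
Lemma cut_cup : hull (v :: V) = hull V `|` hull [:: v; u; w].
Proof.
apply/seteqP; split.
  apply: hull_sub => // p; rewrite inE => /orP[/eqP ->|pV].
    by right; apply: mem_hull; rewrite mem_head.
  by left; exact: mem_hull.
move=> x [|]; apply: hull_mono => p; first by rewrite inE => ->; rewrite orbT.
by rewrite !inE => /or3P[]/eqP ->; rewrite ?eqxx// (uV, wV) orbT.
Qed.

End Cut.

End ConvexHull.

(** * Lexicographic and angular orders around a vertex *)

Lemma seq_min (T : eqType) (r : rel T) (P : pred T) (s : seq T) :
  {in P &, total r} -> {in P & &, transitive r} -> all P s -> s != [::] ->
  exists2 m, m \in s & {in s, forall p, r m p}.
Proof.
move=> tot tr; elim: s => //= a s IH /andP[Pa Ps] _.
have raa : r a a by have := tot a a Pa Pa; rewrite orbb.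
have [->|/(IH Ps)[m ms mP]] := eqVneq s [::].
  by exists a; rewrite ?mem_head// => p; rewrite inE => /eqP ->.
have Pm := allP Ps _ ms.
have [ram|rma] := orP (tot a m Pa Pm).
  exists a; first exact: mem_head.
  move=> p; rewrite inE => /orP[/eqP -> //|ps].
  exact: (tr m a p Pm Pa (allP Ps _ ps) ram (mP _ ps)).
exists m; first by rewrite inE ms orbT.
by move=> p; rewrite inE => /orP[/eqP -> //|/mP].
Qed.

Definition lexlt (p q : int * int) : bool :=
  (p.1 < q.1) || ((p.1 == q.1) && (p.2 < q.2)).

Lemma lexlt_total p q : p != q -> lexlt p q || lexlt q p.
Proof.
case: p q => [a b] [c d]; rewrite /lexlt xpair_eqE /= => h.
by move: h; case: (ltgtP a c) => //= _; case: ltgtP.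
Qed.

Lemma lexlt_trans : transitive lexlt.
Proof. by move=> [a b] [c d] [e f]; rewrite /lexlt /=; lia. Qed.

Lemma lexlt_irr p : lexlt p p = false.
Proof. by rewrite /lexlt; lia. Qed.

Lemma angle_total (v a b : int * int) : (0 <= det3 v a b) || (0 <= det3 v b a).
Proof.
have -> : det3 v b a = - det3 v a b by rewrite /det3; ring.
by lia.
Qed.

(** Vectors from [v] to lexicographically later points have angles in (-pi/2, pi/2], so comparing
    angles cannot wrap around. Without that restriction transitivity fails, which is why [seq_min]
    is relative to a predicate. *)
Lemma angle_trans (v a b c : int * int) : lexlt v a -> lexlt v b -> lexlt v c ->
  0 <= det3 v a b -> 0 <= det3 v b c -> 0 <= det3 v a c.
Proof.
rewrite /lexlt /det3.
set a1 := a.1 - v.1; set a2 := a.2 - v.2.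
set b1 := b.1 - v.1; set b2 := b.2 - v.2.
set c1 := c.1 - v.1; set c2 := c.2 - v.2.
have ha : (v.1 < a.1) || ((v.1 == a.1) && (v.2 < a.2)) = (0 < a1) || ((0 == a1) && (0 < a2)).
  by rewrite /a1 /a2; lia.
have hb : (v.1 < b.1) || ((v.1 == b.1) && (v.2 < b.2)) = (0 < b1) || ((0 == b1) && (0 < b2)).
  by rewrite /b1 /b2; lia.
have hc : (v.1 < c.1) || ((v.1 == c.1) && (v.2 < c.2)) = (0 < c1) || ((0 == c1) && (0 < c2)).
  by rewrite /c1 /c2; lia.
rewrite ha hb hc; move: a1 a2 b1 b2 c1 c2 {ha hb hc} => a1 a2 b1 b2 c1 c2 ha hb hc ab bc.
have key : b1 * (a1 * c2 - a2 * c1) = a1 * (b1 * c2 - b2 * c1) + c1 * (a1 * b2 - a2 * b1).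
  by ring.
have a0 : 0 <= a1 by lia.
have c0 : 0 <= c1 by lia.
case/orP: hb => [b0|/andP[/eqP b0 b20]].
  by rewrite -(pmulr_rge0 _ b0) key addr_ge0// mulr_ge0.
(* Here [b] points straight up, the largest admissible angle, so [c] points straight up too. *)
subst b1; have c10 : c1 = 0 by nia.
by subst c1; nia.
Qed.

(** * Splitting a polygon at its lexicographically least vertex *)

Section Fan.
Context {R : realType}.
Implicit Types (s : seq (int * int)) (p u v w : int * int).
Local Notation hull := (@hull R).

(** On a line the lexicographic order is the order of position. The parameter is read off the first
    coordinates, or off the second ones if the line is vertical. *)
Lemma collinear_hull2 v z p : lexlt v z -> lexlt v p -> ~~ lexlt z p ->
  det3 v z p = 0 -> hull [:: v; z] (emb p).
Proof.
move=> vz vp pz d0; apply/hull2.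
have e0 : det3 (emb v) (emb z) (emb p) = 0 :> R by rewrite det3_emb d0.
move: e0; case: v z p vz vp pz d0 => [v1 v2] [z1 z2] [p1 p2]; rewrite /lexlt /det3 /emb /=.
have [vz1 _ vp|] := ltP v1 z1.
  move=> pz _ e0.
  have vz1R : (v1%:~R < z1%:~R :> R) by rewrite ltr_int.
  have vp1R : (v1%:~R <= p1%:~R :> R) by rewrite ler_int; lia.
  have pz1R : (p1%:~R <= z1%:~R :> R) by rewrite ler_int; lia.
  have n0 : z1%:~R - v1%:~R != 0 :> R by rewrite subr_eq0 gt_eqF.
  exists ((z1%:~R - p1%:~R) / (z1%:~R - v1%:~R)).
    by rewrite divr_ge0 ?ler_pdivrMr ?subr_gt0// ?mul1r; lra.
  congr pair; first by field.
  apply: (mulfI n0); move: e0 => /eqP; rewrite subr_eq0 => /eqP e0.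
  rewrite -[LHS](subrK ((z1%:~R - v1%:~R) * v2%:~R)) -mulrBr e0; by field.
move=> zv /= vz vp pz d0 _.
have ez : z1 = v1 by lia.
subst z1; have ep : p1 = v1.
  have /eqP := d0; rewrite subrr mul0r sub0r oppr_eq0 mulf_eq0 subr_eq0 => /orP[|]; lia.
subst p1.
have vz1R : (v2%:~R < z2%:~R :> R) by rewrite ltr_int; lia.
have vp1R : (v2%:~R <= p2%:~R :> R) by rewrite ler_int; lia.
have pz1R : (p2%:~R <= z2%:~R :> R) by rewrite ler_int; lia.
have n0 : z2%:~R - v2%:~R != 0 :> R by rewrite subr_eq0 gt_eqF.
exists ((z2%:~R - p2%:~R) / (z2%:~R - v2%:~R)).
  by rewrite divr_ge0 ?ler_pdivrMr ?subr_gt0// ?mul1r; lra.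
by congr pair; field.
Qed.

(* [v] is the lexicographic minimum of [s]; [u] and [w] are extreme in the
   angular order around [v], so the line [u w] cuts off the triangle [v u w]. *)
Lemma fan_decomposition s : s != [::] ->
  (exists u w, hull s = hull [:: u; w]) \/
  exists v u w V, [/\ (size V < size s)%N, 0 < det3 v u w, (u \in V) && (w \in V),
    forall p, p \in V -> [/\ 0 <= det3 v u p, 0 <= det3 w v p & det3 u w p <= 0] &
    hull s = hull (v :: V)].
Proof.
move=> s0.
have [v vs vmin] : exists2 v, v \in s & {in s, forall p, ~~ lexlt p v}.
  apply: (@seq_min _ (fun p q => ~~ lexlt q p) predT) => //; last exact/allP.
    move=> p q _ _; case: (boolP (lexlt q p)) => //= h; apply/negP => h'.
    by have := lexlt_trans h h'; rewrite lexlt_irr.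
  move=> q p r _ _ _ h1 h2; apply/negP => rp.
  have [pq|pq] := eqVneq p q; first by rewrite -pq rp in h2.
  have := lexlt_total pq; rewrite (negbTE h1) orbF => pq'.
  by have := lexlt_trans rp pq'; rewrite (negbTE h2).
pose s' := [seq p <- s | lexlt v p].
have sE p : p \in s -> p = v \/ p \in s'.
  move=> ps; have [->|pv] := eqVneq p v; first by left.
  right; rewrite mem_filter ps andbT.
  by have := lexlt_total pv; rewrite (negbTE (vmin _ ps)).
have s'P p : p \in s' -> lexlt v p /\ p \in s by rewrite mem_filter => /andP.
have s'lex : all (lexlt v) s' by apply/allP => p /s'P[].
have [s'0|s'0] := eqVneq s' [::].
  left; exists v, v; apply: eq_hull => p; rewrite !inE orbb; apply/idP/eqP => [/sE[//|]|->//].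
  by rewrite s'0.
have [u us umin] : exists2 u, u \in s' & {in s', forall p, 0 <= det3 v u p}.
  apply: (@seq_min _ (fun a b => 0 <= det3 v a b) (lexlt v)) => //.
    by move=> a b _ _; exact: angle_total.
  by move=> b a c vb va vc; exact: angle_trans.
have [w ws wmax] : exists2 w, w \in s' & {in s', forall p, 0 <= det3 v p w}.
  apply: (@seq_min _ (fun a b => 0 <= det3 v b a) (lexlt v)) => //.
    by move=> a b _ _; exact: angle_total.
  by move=> b a c vb va vc h1 h2; exact: angle_trans h2 h1.
have [vu us1] := s'P _ us; have [vw ws1] := s'P _ ws.
have := umin _ ws; rewrite le_eqVlt => /orP[/eqP d0|d0].
  left.
  (* The extreme directions coincide, so all points are on one ray from [v]; [z] is the farthest of
     them. *)
  have [z zs zmax] : exists2 z, z \in s' & {in s', forall p, ~~ lexlt z p}.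
    apply: (@seq_min _ (fun p q => ~~ lexlt p q) predT) => //; last exact/allP.
      move=> p q _ _; case: (boolP (lexlt p q)) => //= h; apply/negP => h'.
      by have := lexlt_trans h h'; rewrite lexlt_irr.
    move=> q p r _ _ _ h1 h2; apply/negP => pr.
    have [pq|pq] := eqVneq p q; first by rewrite -pq pr in h2.
    have := lexlt_total pq; rewrite (negbTE h1) /= => qp.
    by have := lexlt_trans qp pr; rewrite (negbTE h2).
  have [vz zs1] := s'P _ zs.
  exists v, z; apply/seteqP; split; apply: sub_hull => p; last first.
    by rewrite !inE => /orP[]/eqP ->; exact: mem_hull.
  move=> /sE[->|ps]; first by apply: mem_hull; rewrite mem_head.
  have [vp _] := s'P _ ps.
  apply: collinear_hull2 => //; first exact: zmax.
  have wu : 0 <= det3 v w u by rewrite -det3_cycle det3_swap det3_cycle -d0 oppr0.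
  (* Both signs come from the angular chains z, w, u, p and p, w, u, z, where [wu] closes the step
     from [w] back to [u]. *)
  apply/eqP; rewrite eq_le; apply/andP; split; last first.
    by apply: (angle_trans vz vu vp) (umin _ ps); apply: (angle_trans vz vw vu) wu; exact: wmax.
  rewrite -oppr_ge0 -det3_cycle -det3_swap det3_cycle.
  by apply: (angle_trans vp vu vz) (umin _ zs); apply: (angle_trans vp vw vu) wu; exact: wmax.
(* [V] keeps the points on the far side of the chord. It loses at least [v], hence is shorter than
   [s]. *)
right; pose V := [seq p <- s | det3 u w p <= 0].
have dv : (det3 u w v <= 0) = false by rewrite det3_cycle leNgt d0.
exists v, u, w, V; split => //.
- rewrite size_filter -(count_predC (fun p => det3 u w p <= 0) s) -[X in (X < _)%N]addn0 ltn_add2l -has_count.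
  by apply/hasP; exists v => //=; rewrite dv.
- have e1 : det3 u w u = 0 by rewrite /det3; ring.
  have e2 : det3 u w w = 0 by rewrite /det3; ring.
  by rewrite !mem_filter us1 ws1 e1 e2.
- move=> p; rewrite mem_filter => /andP[hp /sE[pv|ps]]; first by rewrite pv dv in hp.
  split => //; first exact: umin.
  by rewrite -det3_cycle; exact: wmax.
- apply/seteqP; split; apply: sub_hull => p; last first.
    by rewrite inE mem_filter => /orP[/eqP ->|/andP[_]] //; exact: mem_hull.
  move=> /sE[->|ps]; first by apply: mem_hull; rewrite mem_head.
  have [hp|hp] := boolP (det3 u w p <= 0).
    by apply: mem_hull; rewrite inE mem_filter hp (s'P _ ps).2 orbT.
  (* A point left out of [V] is on the same side of the chord as [v], hence inside the triangle. *)
  have : hull [:: v; u; w] (emb p).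
    rewrite hull3// /left_side /=; rewrite !det3_emb !ler0z; repeat split.
    + exact: umin.
    + by rewrite ltW// ltNge.
    + by rewrite -det3_cycle; exact: wmax.
  apply: hull_mono => q; rewrite !inE !mem_filter => /or3P[]/eqP ->; rewrite ?eqxx// (us1, ws1) andbT;
    by rewrite [det3 _ _ _](_ : _ = 0) ?lexx ?orbT// /det3; ring.
Qed.

(** Reduces properties stable under union, such as closedness and measurability, to segments and
    nondegenerate triangles. *)
Lemma hull_ind (Pr : set (R * R) -> Prop) : Pr set0 ->
  (forall u w, Pr (hull [:: u; w])) ->
  (forall u v w, 0 < det3 u v w -> Pr (hull [:: u; v; w])) ->
  (forall A B, Pr A -> Pr B -> Pr (A `|` B)) ->
  forall s, Pr (hull s).
Proof.
move=> P0 P2 P3 PU s; have [n] := ubnP (size s); elim: n s => // n IH s sn.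
have [->|/fan_decomposition[[u [w ->]]|]] := eqVneq s [::]; first by rewrite hull0.
  exact: P2.
move=> [v [u [w [V [Vs d0 /andP[uV wV] cone ->]]]]]; rewrite (cut_cup d0 uV wV cone).
by apply: PU; [apply: IH; exact: leq_trans Vs _|exact: P3].
Qed.

End Fan.

(** * Area under unimodular affine maps *)

Section PlaneMeasure.
Context {R : realType}.
Local Notation mT := (measurableTypeR R).
Local Notation mu := (@lebesgue_measure R \x @lebesgue_measure R)%E.

(** The translated measure has the right values on half-open intervals, and these determine Lebesgue
    measure. *)
Lemma lebesgue_measure_translation (t : R) (A : set mT) : measurable A ->
  lebesgue_measure ((fun x : mT => x + t) @^-1` A) = lebesgue_measure A.
Proof.
move=> mA.
have mf : measurable_fun [set: mT] (fun x : mT => x + t : mT).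
  by apply: measurable_funD => //; exact: measurable_cst.
have := @lebesgue_measure_unique R (pushforward lebesgue_measure (fun x : mT => x + t : mT)).
rewrite -/(pushforward lebesgue_measure (fun x : mT => x + t : mT) A) => <- //.
move=> _ [[a b] _ <-] /=; rewrite /pushforward.
have -> : (fun x : mT => x + t) @^-1` `]a, b] = `]a - t, b - t]%classic.
  by apply/seteqP; split=> x /=; rewrite !in_itv /= ltrBlDr lerBrDr.
rewrite !lebesgue_measure_itv /= !lte_fin ltrD2r; case: ifPn => // _.
by rewrite -!EFinD; congr (_%:E); ring.
Qed.

Definition preserves_area (f : R * R -> R * R) : Prop := forall A : set (mT * mT),
  measurable A -> measurable (f @^-1` A : set (mT * mT)) /\ mu (f @^-1` A) = mu A.

Lemma preserves_area_comp f g :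
  preserves_area f -> preserves_area g -> preserves_area (g \o f).
Proof. by move=> hf hg A /hg[/hf[? h] <-]; split => //; rewrite -h. Qed.

(** Both orders of integration agree on rectangles. The order on the right integrates the lengths of
    horizontal sections, which a horizontal shear merely translates. *)
Lemma mu_ysection (A : set (mT * mT)) : measurable A ->
  mu A = (@lebesgue_measure R \x^ @lebesgue_measure R)%E A.
Proof.
by apply: product_measure_unique => B C mB mC /=; rewrite product_measure2E.
Qed.

Lemma preserves_area_swap : preserves_area (fun x => (x.2, x.1)).
Proof.
move=> A mA.
have mS : measurable ((fun x : R * R => (x.2, x.1)) @^-1` A : set (mT * mT)).
  rewrite -[X in measurable X]setTI.
  have mf : measurable_fun [set: mT * mT] (fun x : mT * mT => (x.2, x.1)).
    by apply/measurable_fun_pairP; split; [exact: measurable_snd|exact: measurable_fst].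
  exact: mf.
by split => //; rewrite [RHS]mu_ysection.
Qed.

(** Cavalieri's principle: the section at height [y] is translated by [h y]. *)
Lemma preserves_area_shear (h : R -> R) : measurable_fun [set: mT] (h : mT -> mT) ->
  preserves_area (fun x => (x.1 + h x.2, x.2)).
Proof.
move=> mh A mA.
have mS : measurable ((fun x : R * R => (x.1 + h x.2, x.2)) @^-1` A : set (mT * mT)).
  rewrite -[X in measurable X]setTI.
  have mf : measurable_fun [set: mT * mT] (fun x : mT * mT => (x.1 + h x.2 : mT, x.2)).
    apply/measurable_fun_pairP; split; last exact: measurable_snd.
    apply: measurable_funD; first exact: measurable_fst.
    by apply: measurableT_comp => //; exact: measurable_snd.
  exact: mf.
split => //; rewrite !mu_ysection// /product_measure2.
apply: eq_integral => y _ /=.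
rewrite -(@lebesgue_measure_translation (h y) (ysection A y)); last exact: measurable_ysection.
by congr (lebesgue_measure _); rewrite !ysectionE.
Qed.

Lemma preserves_area_shearX (k t : R) : preserves_area (fun x => (x.1 + k * x.2 + t, x.2)).
Proof.
have : measurable_fun [set: mT] (fun y : mT => k * y + t : mT).
  by apply: measurable_funD => //; exact: measurable_cst.
by move=> /preserves_area_shear; congr preserves_area; apply/funext => x; rewrite addrA.
Qed.

Lemma preserves_area_shearY (k t : R) : preserves_area (fun x => (x.1, x.2 + k * x.1 + t)).
Proof.
have := preserves_area_comp (preserves_area_comp preserves_area_swap (preserves_area_shearX k t))
  preserves_area_swap.
by congr preserves_area; apply/funext => x.
Qed.

Definition affine_fun (T : comPzRingType) (a b c d e f : T) (x : T * T) : T * T :=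
  (a * x.1 + b * x.2 + e, c * x.1 + d * x.2 + f).

(* When [c != 0], [[a b; c d]] is the product of the unipotent matrices
   [[1 (a-1)/c; 0 1]], [[1 0; c 1]] and [[1 (d-1)/c; 0 1]]. *)
Let preserves_area_affine_c (a b c d e f : R) : c != 0 -> a * d - b * c = 1 ->
  preserves_area (affine_fun a b c d e f).
Proof.
move=> c0 adbc.
have := preserves_area_comp (preserves_area_comp (preserves_area_shearX ((d - 1) / c) 0)
  (preserves_area_shearY c f)) (preserves_area_shearX ((a - 1) / c) (e - (a - 1) / c * f)).
congr preserves_area; apply/funext => x; rewrite /affine_fun /=.
have -> : b = (a * d - 1) / c by rewrite -adbc; field.
by congr pair; field.
Qed.

(** If [c = 0] then [a != 0]. Adding the first row to the second puts [a] in the lower left corner,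
    and a shear undoes the addition. *)
Let preserves_area_affine1 (a b c d e f : R) : a * d - b * c = 1 ->
  preserves_area (affine_fun a b c d e f).
Proof.
move=> adbc; have [c0|c0] := eqVneq c 0; last exact: preserves_area_affine_c.
have a0 : a != 0.
  by apply/eqP => a0; move: adbc; rewrite c0 a0 mul0r mulr0 subr0 => /eqP; rewrite eq_sym oner_eq0.
have := preserves_area_comp (@preserves_area_affine_c a b a (b + d) e (e + f) a0 _)
  (preserves_area_shearY (-1) 0).
rewrite (_ : a * (b + d) - b * a = 1); last by rewrite -adbc c0; ring.
move=> /(_ erefl); congr preserves_area; apply/funext => x; rewrite /affine_fun /= c0.
by congr pair; ring.
Qed.

Lemma preserves_area_affine (a b c d e f : R) : (a * d - b * c) ^+ 2 = 1 ->
  preserves_area (affine_fun a b c d e f).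
Proof.
move=> /eqP; rewrite sqrf_eq1 => /orP[/eqP|/eqP] adbc; first exact: preserves_area_affine1.
have := preserves_area_comp (@preserves_area_affine1 c d a b f e _) preserves_area_swap.
rewrite (_ : c * b - d * a = 1); last by lra.
by move=> /(_ erefl); congr preserves_area.
Qed.

End PlaneMeasure.

(** * Topology and measurability of lattice polygons *)

Section PolytopeSets.
Context {R : realType}.
Implicit Types (s : seq (int * int)) (p u v w : int * int).
Local Notation hull := (@hull R).
Local Notation mT := (measurableTypeR R).
Local Notation mu := (@lebesgue_measure R \x @lebesgue_measure R)%E.

Let nice (A : set (R * R)) : Prop := closed A /\ measurable (A : set (mT * mT)).

Let niceI A B : nice A -> nice B -> nice (A `&` B).
Proof. by move=> [? ?] [? ?]; split; [exact: closedI|exact: measurableI]. Qed.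

Let nice_halfplane (a b c : R) : nice [set x | 0 <= a * x.1 + b * x.2 + c].
Proof.
split.
  rewrite (_ : mkset _ = (fun x : R * R => a * x.1 + b * x.2 + c) @^-1` [set r | 0 <= r])//.
  apply: preimage_closed; last exact: closed_ge.
  move=> x _; apply: cvgD; last exact: cvg_cst.
  by apply: cvgD; apply: cvgMl_tmp; [exact: cvg_fst|exact: cvg_snd].
rewrite -[X in measurable X]setTI.
have mf : measurable_fun [set: mT * mT] (fun x : mT * mT => a * x.1 + b * x.2 + c : mT).
  apply: measurable_funD; last exact: measurable_cst.
  apply: measurable_funD; apply: measurable_funM.
  - exact: measurable_cst.
  - exact: measurable_fst.
  - exact: measurable_cst.
  - exact: measurable_snd.
have -> : [set x : R * R | 0 <= a * x.1 + b * x.2 + c] =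
  (fun x : mT * mT => a * x.1 + b * x.2 + c : mT) @^-1` `[0, +oo[%classic.
  by apply/seteqP; split=> x /=; rewrite in_itv /= andbT.
exact: mf.
Qed.

Let nice_left_side (u v : R * R) : nice (left_side u v).
Proof. by rewrite left_sideE. Qed.

Let nice_hull2 u w : nice (hull [:: u; w]).
Proof.
have [->|uw] := eqVneq u w.
  rewrite (_ : hull _ = [set emb w]); last first.
    by rewrite -hull1; apply: eq_hull => p; rewrite !inE orbb.
  rewrite (_ : [set emb w] = [set x : R * R | 0 <= 1 * x.1 + 0 * x.2 + - w.1%:~R]
    `&` [set x : R * R | 0 <= -1 * x.1 + 0 * x.2 + w.1%:~R]
    `&` [set x : R * R | 0 <= 0 * x.1 + 1 * x.2 + - w.2%:~R]
    `&` [set x : R * R | 0 <= 0 * x.1 + -1 * x.2 + w.2%:~R]); first by do !apply: niceI.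
  apply/seteqP; split=> [_ ->|[x y] /= [[[h1 h2] h3] h4]]; rewrite /emb /=.
    by repeat split; rewrite !(mul0r, mul1r, addr0, add0r, mulN1r) ?subrr ?addNr.
  by congr pair; lra.
(* [n] is the direction of the segment. Two half-planes cut out its line; two more, orthogonal to
   [n], bound it at [u] and at [w]. *)
pose n : R * R := ((emb w).1 - (emb u).1, (emb w).2 - (emb u).2).
rewrite (_ : hull _ = left_side (emb u) (emb w) `&` left_side (emb w) (emb u)
  `&` [set x : R * R | 0 <= n.1 * x.1 + n.2 * x.2 + - (n.1 * (emb u).1 + n.2 * (emb u).2)]
  `&` [set x : R * R | 0 <= - n.1 * x.1 + - n.2 * x.2 + (n.1 * (emb w).1 + n.2 * (emb w).2)]);
  first by do !apply: niceI.
have N0 : 0 < n.1 ^+ 2 + n.2 ^+ 2.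
  rewrite lt_neqAle addr_ge0 ?sqr_ge0// andbT eq_sym; apply/negP => /eqP h.
  have /eqP : n.1 ^+ 2 = 0 by have := sqr_ge0 n.1; have := sqr_ge0 n.2; lra.
  have /eqP : n.2 ^+ 2 = 0 by have := sqr_ge0 n.1; have := sqr_ge0 n.2; lra.
  rewrite !sqrf_eq0 /n /= !subr_eq0 !eqr_int => /eqP e2 /eqP e1.
  by move/eqP: uw; apply; case: u w e1 e2 {n h} => ? ? [? ?] /= -> ->.
apply/seteqP; split.
  apply: hull_sub.
    by do !apply: pconvexI; (exact: left_side_convex || exact: halfplane_convex).
  move=> p; rewrite !inE /left_side /det3 => /orP[]/eqP -> /=; repeat split; move: N0;
    rewrite /n /emb /=; nra.
move=> [x y] [[[]]]; rewrite /left_side /det3 /= => h1 h2 h3 h4; apply/hull2.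
have n0 : n.1 ^+ 2 + n.2 ^+ 2 != 0 by rewrite gt_eqF.
have e : n.1 * (y - (emb u).2) = n.2 * (x - (emb u).1).
  by move: h1 h2; rewrite /n /emb /=; lra.
(* The normalized projection onto [n] of the vector from the point to [w], which is the weight of
   [u]. *)
pose t := (n.1 * ((emb w).1 - x) + n.2 * ((emb w).2 - y)) / (n.1 ^+ 2 + n.2 ^+ 2).
exists t.
  apply/andP; split; rewrite /t.
    by rewrite divr_ge0// ?(ltW N0)//; move: h4; rewrite /n /emb /=; lra.
  by rewrite ler_pdivrMr// mul1r; move: h3; rewrite /n /emb /=; lra.
have e' : n.1 * ((emb w).2 - y) = n.2 * ((emb w).1 - x).
  by move: e; rewrite /n /emb /=; lra.
have tx : t * n.1 = (emb w).1 - x.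
  apply: (mulIf n0); rewrite /t mulrAC divfK//.
  by transitivity (n.1 * (n.1 * ((emb w).1 - x)) + n.2 * (n.1 * ((emb w).2 - y))); [ring|rewrite e'; ring].
have ty : t * n.2 = (emb w).2 - y.
  apply: (mulIf n0); rewrite /t mulrAC divfK//.
  by transitivity (n.1 * (n.2 * ((emb w).1 - x)) + n.2 * (n.2 * ((emb w).2 - y))); [ring|rewrite -e'; ring].
move: tx ty; rewrite /n /= => tx ty; congr pair; lra.
Qed.

Let nice_hull s : nice (hull s).
Proof.
apply: hull_ind => [|u w|u v w d0|A B [? ?] [? ?]].
- by split; [exact: closed0|exact: measurable0].
- exact: nice_hull2.
- by rewrite hull3//; do !apply: niceI.
- by split; [exact: closedU|exact: measurableU].
Qed.

Lemma closed_lpset (P : latticePolytope R) : closed (lpset P).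
Proof. by have [s ->] := polyP P; case: (nice_hull s). Qed.

Lemma measurable_lpset (P : latticePolytope R) : measurable (lpset P : set (mT * mT)).
Proof. by have [s ->] := polyP P; case: (nice_hull s). Qed.

Lemma bounded_lpset (P : latticePolytope R) : exists M : nat,
  lpset P `<=` `[- M%:R, M%:R]%classic `*` `[- M%:R, M%:R]%classic.
Proof.
have [s ->] := polyP P.
have [M sM] : exists M : nat, forall p, p \in s -> (absz p.1 <= M)%N /\ (absz p.2 <= M)%N.
  elim: s => [|q s [M IH]]; first by exists 0.
  exists (M + `|q.1| + `|q.2|)%N => p; rewrite inE => /orP[/eqP ->|/IH]; lia.
exists M; apply: hull_sub.
  have cI : pconvex ([set x : R * R | 0 <= 1 * x.1 + 0 * x.2 + M%:R]
    `&` [set x : R * R | 0 <= -1 * x.1 + 0 * x.2 + M%:R]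
    `&` [set x : R * R | 0 <= 0 * x.1 + 1 * x.2 + M%:R]
    `&` [set x : R * R | 0 <= 0 * x.1 + -1 * x.2 + M%:R]).
    by do !apply: pconvexI; exact: halfplane_convex.
  move: cI; congr pconvex; apply/seteqP; split=> -[x y] /=; rewrite !in_itv /=.
    by move=> [[[? ?] ?] ?]; split; apply/andP; split; lra.
  by move=> [/andP[? ?] /andP[? ?]]; repeat split; lra.
move=> [p1 p2] /sM[/= h1 h2]; rewrite /emb /= !in_itv /= [M%:R]pmulrn -mulrNz !ler_int; split; lia.
Qed.

Lemma finite_lattice_points (P : latticePolytope R) : finite_set (lpset P `&` Z2).
Proof.
have [M PM] := bounded_lpset P.
(* Shifted down by [M], the 2M + 1 ordinals enumerate the integers of [-M, M]. *)
apply: (@sub_finite_set _ _ ((fun ij : 'I_(M + M).+1 * 'I_(M + M).+1 =>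
   emb (Posz ij.1 - Posz M, Posz ij.2 - Posz M)) @` setT)).
  move=> x [/PM Px /Z2_emb[[p1 p2] xp]]; move: Px; rewrite {}xp /emb /= !in_itv /=.
  rewrite [M%:R]pmulrn -mulrNz !ler_int => -[h1 h2].
  have l1 : (absz (p1 + Posz M)%R < (M + M).+1)%N by lia.
  have l2 : (absz (p2 + Posz M)%R < (M + M).+1)%N by lia.
  by exists (Ordinal l1, Ordinal l2) => //=; congr (_%:~R, _%:~R); lia.
exact/finite_image/finite_finset.
Qed.

Lemma mu_lpset_fin (P : latticePolytope R) : mu (lpset P) \is a fin_num.
Proof.
have [M PM] := bounded_lpset P.
rewrite ge0_fin_numE; last exact: measure_ge0.
have mI : measurable (`[- M%:R, M%:R]%classic : set mT) by exact: measurable_itv.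
apply: (@le_lt_trans _ _ (mu (`[- M%:R, M%:R]%classic `*` `[- M%:R, M%:R]%classic))).
  apply: le_measure => //; rewrite inE; first exact: measurable_lpset.
  exact: measurableX.
rewrite product_measure1E//.
have fI : (lebesgue_measure (`[(- M%:R)%R, (M%:R)%R]%classic : set mT) < +oo)%E.
  by rewrite lebesgue_measure_itv /=; case: ifP => // _; rewrite -EFinB ltry.
by rewrite lte_mul_pinfty// ge0_fin_numE.
Qed.

End PolytopeSets.

(** * Lattice automorphisms *)

Section AffineMaps.
Context {R : realType}.
Implicit Types (s : seq (int * int)) (a b c d e f : int).

Definition linear_fun (a b c d : R) (x : R * R) : R * R :=
  (a * x.1 + b * x.2, c * x.1 + d * x.2).

Lemma linear_fun_is_linear (a b c d : R) : linear (linear_fun a b c d).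
Proof.
move=> k [x1 x2] [y1 y2].
change (linear_fun a b c d (k * x1 + y1, k * x2 + y2) =
  (k * (a * x1 + b * x2) + (a * y1 + b * y2), k * (c * x1 + d * x2) + (c * y1 + d * y2))).
by rewrite /linear_fun /=; congr pair; ring.
Qed.

HB.instance Definition _ (a b c d : R) := GRing.isLinear.Build R (R * R)%type (R * R)%type _
  (linear_fun a b c d) (linear_fun_is_linear a b c d).

Definition affine_int a b c d e f : R * R -> R * R :=
  affine_fun a%:~R b%:~R c%:~R d%:~R e%:~R f%:~R.

Lemma affine_int_emb a b c d e f p :
  affine_int a b c d e f (emb p) = emb (affine_fun a b c d e f p).
Proof. by rewrite /affine_int /affine_fun /emb /= !(intrD, intrM). Qed.

Lemma affine_int_affine a b c d e f : affine_map (affine_int a b c d e f).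
Proof.
exists (linear_fun a%:~R b%:~R c%:~R d%:~R : {linear (R * R)%type -> (R * R)%type}), (e%:~R, f%:~R).
by move=> x.
Qed.

Lemma affine_int_Z2 a b c d e f : (a * d - b * c) ^+ 2 = 1 ->
  affine_int a b c d e f @` Z2 = Z2.
Proof.
move=> D1; apply/seteqP; split=> [_ [x /Z2_emb[p ->] <-]|_ /Z2_emb[[p q] ->]].
  by apply/Z2_emb; eexists; exact: affine_int_emb.
pose D := a * d - b * c.
(* Cramer's rule, with [D] as its own inverse. *)
exists (emb (D * (d * (p - e) - b * (q - f)), D * (a * (q - f) - c * (p - e)))).
  by apply/Z2_emb; eexists.
rewrite affine_int_emb /affine_fun /=; congr emb; congr pair.
  transitivity (D ^+ 2 * (p - e) + e); first by rewrite /D; ring.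
  by rewrite D1 mul1r subrK.
transitivity (D ^+ 2 * (q - f) + f); first by rewrite /D; ring.
by rewrite D1 mul1r subrK.
Qed.

Lemma affine_hull a b c d e f s :
  affine_int a b c d e f @` hull s = hull (map (affine_fun a b c d e f) s).
Proof.
set T := affine_int a b c d e f.
have Tconv (x y : R * R) (t : R) : T (t * x.1 + (1 - t) * y.1, t * x.2 + (1 - t) * y.2) =
    (t * (T x).1 + (1 - t) * (T y).1, t * (T x).2 + (1 - t) * (T y).2).
  by rewrite /T /affine_int /affine_fun /=; congr pair; ring.
apply/seteqP; split.
  suff : hull s `<=` T @^-1` hull (map (affine_fun a b c d e f) s).
    by move=> h _ [x /h ? <-].
  apply: hull_sub => [x y t t0 t1 /= hx hy|p ps /=].
    by rewrite Tconv; exact: hull_convex.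
  by rewrite /T affine_int_emb; apply: mem_hull; exact: map_f.
apply: hull_sub => [_ _ t t0 t1 [x hx <-] [y hy <-]|_ /mapP[p ps ->]].
  by exists (t * x.1 + (1 - t) * y.1, t * x.2 + (1 - t) * y.2); [exact: hull_convex|exact: Tconv].
by exists (emb p); [exact: mem_hull|exact: affine_int_emb].
Qed.

(** The images of (0, 0), (1, 0) and (0, 1) are lattice points and give integer entries.
    Surjectivity gives integer preimages of T(0) + e1 and T(0) + e2, the columns of an integer
    inverse matrix, so the determinant is a unit. *)
Lemma lattice_automorphismP (T : R * R -> R * R) : affine_map T -> T @` Z2 = Z2 ->
  exists a b c d e f, (a * d - b * c) ^+ 2 = 1 /\ T = affine_int a b c d e f.
Proof.
move=> [L [t TL]] TZ.
have TZ2 p : exists q, T (emb p) = emb q.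
  by apply/Z2_emb; rewrite -TZ; exists (emb p) => //; apply/Z2_emb; exists p.
have TZ2V q : exists p, T (emb p) = emb q.
  have : Z2 (emb q : R * R) by apply/Z2_emb; exists q.
  by rewrite -TZ => -[_ /Z2_emb[p ->] <-]; exists p.
have [[e f] T0] := TZ2 (0, 0); have [[p1 p2] Tp] := TZ2 (1, 0); have [[q1 q2] Tq] := TZ2 (0, 1).
have tE : t = emb (e, f) by rewrite -T0 TL (_ : emb (0, 0) = 0) ?linear0 ?add0r.
have L1 : L (emb (1, 0)) = emb (p1 - e, p2 - f).
  by move: Tp; rewrite TL tE => /(canRL (addrK _)) ->; rewrite /emb /= !intrB.
have L2 : L (emb (0, 1)) = emb (q1 - e, q2 - f).
  by move: Tq; rewrite TL tE => /(canRL (addrK _)) ->; rewrite /emb /= !intrB.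
have TE : T = affine_int (p1 - e) (q1 - e) (p2 - f) (q2 - f) e f.
  apply/funext => x.
  have xE : x = x.1 *: emb (1, 0) + x.2 *: emb (0, 1).
    case: x => x y; change ((x, y) = (x * 1 + y * 0, x * 0 + y * 1) :> R * R).
    by congr pair; ring.
  rewrite TL {1}xE linearD !linearZ_LR /= L1 L2 tE; case: x {xE} => x y.
  change ((x * (p1 - e)%:~R + y * (q1 - e)%:~R + e%:~R,
    x * (p2 - f)%:~R + y * (q2 - f)%:~R + f%:~R) =
    affine_int (p1 - e) (q1 - e) (p2 - f) (q2 - f) e f (x, y)).
  by rewrite /affine_int /affine_fun /=; congr pair; ring.
exists (p1 - e), (q1 - e), (p2 - f), (q2 - f), e, f; split => //.
move: (p1 - e) (q1 - e) (p2 - f) (q2 - f) TE => a b c d {L1 L2 Tp Tq T0 TZ2} TE.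
have [[m1 m2] /= ] := TZ2V (1 + e, f); rewrite TE affine_int_emb => /emb_inj[h1 h2].
have [[n1 n2] /= ] := TZ2V (e, 1 + f); rewrite TE affine_int_emb => /emb_inj[h3 h4].
rewrite /= in h1 h2 h3 h4.
have k1 : a * m1 + b * m2 = 1 by exact: (addIr e).
have k2 : c * m1 + d * m2 = 0 by apply: (addIr f); rewrite add0r.
have k3 : a * n1 + b * n2 = 0 by apply: (addIr e); rewrite add0r.
have k4 : c * n1 + d * n2 = 1 by exact: (addIr f).
have /(congr1 absz) : (a * d - b * c) * (m1 * n2 - m2 * n1) = 1.
  transitivity ((a * m1 + b * m2) * (c * n1 + d * n2) - (a * n1 + b * n2) * (c * m1 + d * m2)).
    by ring.
  by rewrite k1 k2 k3 k4; ring.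
rewrite abszM absz1 => /eqP; rewrite muln_eq1 => /andP[/eqP D1 _].
by rewrite -real_normK ?num_real// -abszE D1.
Qed.

Lemma affine_int_inj a b c d e f : (a * d - b * c) ^+ 2 = 1 -> injective (affine_int a b c d e f).
Proof.
move=> /(congr1 (fun n : int => n%:~R : R)); rewrite rmorphXn /= rmorphB /= !intrM => D1.
move=> [x y] [x' y'] []; rewrite /= => h1 h2.
have D0 : (a%:~R * d%:~R - b%:~R * c%:~R) != 0 :> R.
  by apply/eqP => h; move: D1; rewrite h expr0n /= => /eqP; rewrite eq_sym oner_eq0.
congr pair; apply: (mulfI D0); move: (a%:~R) (b%:~R) (c%:~R) (d%:~R) (e%:~R) (f%:~R) h1 h2;
  clear => a b c d e f h1 h2.
  by transitivity (d * (a * x + b * y + e) - b * (c * x + d * y + f) - d * e + b * f);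
    [ring|rewrite h1 h2; ring].
by transitivity (a * (c * x + d * y + f) - c * (a * x + b * y + e) - a * f + c * e);
  [ring|rewrite h1 h2; ring].
Qed.

End AffineMaps.

(** * The Euler characteristic, the lattice point count and the area *)

Section Generators.
Context {R : realType}.
Implicit Types (P Q U I : latticePolytope R).
Local Notation mu := (@lebesgue_measure R \x @lebesgue_measure R)%E.

Lemma lpset_convex P : pconvex (lpset P).
Proof. by have [s ->] := polyP P; exact: hull_convex. Qed.

(** Otherwise a segment from a point of [Q] to a point of [P] would stay in the convex [U] and be
    split by two disjoint closed sets, against the connectedness of [0, 1]. This is the one case in
    which additivity of the Euler characteristic is not immediate. *)
Lemma disjoint_polytope_union P Q U : lpset U = lpset P `|` lpset Q ->
  lpset P `&` lpset Q = set0 -> lpset P = set0 \/ lpset Q = set0.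
Proof.
move=> UE PQ0; have [|/set0P[p Pp]] := eqVneq (lpset P) set0; first by left.
have [|/set0P[q Qq]] := eqVneq (lpset Q) set0; first by right.
pose g (t : R) : R * R := (t * p.1 + (1 - t) * q.1, t * p.2 + (1 - t) * q.2).
have gU t : `[0, 1]%classic t -> (lpset P `|` lpset Q) (g t).
  move=> t01; have /andP[t0 t1] : 0 <= t <= 1 by move: t01; rewrite /= in_itv.
  rewrite -UE; apply: lpset_convex => //; rewrite UE.
    by left.
  by right.
have cg : continuous g.
  have h (a b : R) : continuous (fun t : R => t * a + (1 - t) * b).
    move=> t; apply: cvgD; apply: cvgMr_tmp; first exact: cvg_id.
    exact: (cvgB (cvg_cst (1 : R)) cvg_id).
  move=> t; apply: (@cvg_pair _ _ _ (nbhs t) (nbhs (g t).1) (nbhs (g t).2)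
    _ _ _ (fun t : R => t * p.1 + (1 - t) * q.1) (fun t : R => t * p.2 + (1 - t) * q.2));
    exact: h.
have cP : closed (g @^-1` lpset P).
  by apply: preimage_closed; [move=> ? _; exact: cg|exact: closed_lpset].
have cQ : closed (g @^-1` lpset Q).
  by apply: preimage_closed; [move=> ? _; exact: cg|exact: closed_lpset].
have E : `[0, 1]%classic `&` g @^-1` lpset P = `[0, 1]%classic.
  apply: (@segment_connected R 0 1).
  - exists 1; split; first by rewrite /= in_itv /= ler01 lexx.
    by rewrite /g /= !mul1r subrr !mul0r !addr0; case: p Pp {g gU cg cP cQ}.
  - exists (~` (g @^-1` lpset Q)); first exact: closed_openC.
    apply/seteqP; split=> t [t01 h]; split => //.
      by move=> Qt; have : (lpset P `&` lpset Q) (g t) by []; rewrite PQ0.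
    by case: (gU _ t01).
  - by exists (g @^-1` lpset P).
have : (`[0, 1]%classic `&` g @^-1` lpset P) 0 by rewrite E /= in_itv /= lexx ler01.
move=> [_]; rewrite /g /= !mul0r !add0r subr0 !mul1r => Pq.
have : (lpset P `&` lpset Q) q by split => //; case: q Pq {Qq g gU cg cP cQ E}.
by rewrite PQ0.
Qed.

Lemma euler_char_valuation : valuation (@euler_char R).
Proof.
split=> [P P0|P Q U I UE IE]; first by rewrite /euler_char P0 eqxx.
rewrite /euler_char UE IE.
have [P0|P0] := eqVneq (lpset P) set0; first by rewrite P0 set0U set0I eqxx addrC.
have [Q0|Q0] := eqVneq (lpset Q) set0; first by rewrite Q0 setU0 setI0 eqxx (negbTE P0).
have -> : lpset P `|` lpset Q != set0.
  by apply/eqP; rewrite setU_eq0 => -[/eqP]; rewrite (negbTE P0).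
have [/(disjoint_polytope_union UE)[/eqP|/eqP]|//] := eqVneq (lpset P `&` lpset Q) set0.
  by rewrite (negbTE P0).
by rewrite (negbTE Q0).
Qed.

Lemma euler_char_invariant : lattice_invariant (@euler_char R).
Proof.
move=> T _ _ P Q QE; rewrite /euler_char QE.
congr ((~~ _)%:R); apply/eqP/eqP => [/image_set0_set0//|->]; exact: image_set0.
Qed.

Lemma euler_char_monotone : monotone_valuation (@euler_char R).
Proof.
move=> P Q QP; rewrite /euler_char.
have [Q0|/set0P[x /QP Px]] := eqVneq (lpset Q) set0; first by rewrite ler0n.
by rewrite (_ : lpset P != set0)//; apply/set0P; exists x.
Qed.

Lemma lattice_count_valuation : valuation (@lattice_count R).
Proof.
split=> [P P0|P Q U I UE IE]; first by rewrite /lattice_count P0 set0I fset_set0.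
rewrite /lattice_count UE IE setIUl setIIl.
have fP := finite_lattice_points P; have fQ := finite_lattice_points Q.
by rewrite fset_setU// (fset_setI fP fQ) -!natrD cardfsUI.
Qed.

Lemma lattice_count_invariant : lattice_invariant (@lattice_count R).
Proof.
move=> T aT TZ P Q QE; have [a [b [c [d [e [f [D1 TE]]]]]]] := lattice_automorphismP aT TZ.
have injT : injective T by rewrite TE; exact: affine_int_inj.
rewrite /lattice_count QE.
have -> : T @` lpset P `&` Z2 = T @` (lpset P `&` Z2).
  apply/seteqP; split=> [_ [[x Px <-]]|_ [x [Px Zx] <-]].
    by rewrite -{1}TZ => -[y Zy /injT yx]; exists x => //; rewrite -yx in Px *.
  by split; [exists x|rewrite -TZ; exists x].
rewrite fset_set_image; last exact: finite_lattice_points.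
by rewrite card_imfset.
Qed.

Lemma lattice_count_monotone : monotone_valuation (@lattice_count R).
Proof.
move=> P Q QP; rewrite ler_nat; apply: fsubset_leq_card.
by rewrite -fset_set_sub; [exact: setSI|exact: finite_lattice_points..].
Qed.

Lemma vol2_valuation : valuation (@vol2 R).
Proof.
split=> [P P0|P Q U I UE IE]; first by rewrite /vol2 P0 measure0.
rewrite /vol2 UE IE.
have mP := measurable_lpset P; have mQ := measurable_lpset Q.
rewrite [X in fine X + _](measureUfinl mP mQ); last first.
  by rewrite -ge0_fin_numE ?mu_lpset_fin// measure_ge0.
have fI := mu_lpset_fin I; rewrite IE in fI.
have h (x y z : \bar R) : x \is a fin_num -> y \is a fin_num -> z \is a fin_num ->
    fine (x + y - z)%E + fine z = fine x + fine y.
  by move: x y z => [x| |] [y| |] [z| |] // _ _ _ /=; rewrite subrK.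
by apply: h => //; exact: mu_lpset_fin.
Qed.

Lemma vol2_invariant : lattice_invariant (@vol2 R).
Proof.
move=> T aT TZ P Q QE; have [a [b [c [d [e [f [D1 TE]]]]]]] := lattice_automorphismP aT TZ.
have injT : injective T by rewrite TE; exact: affine_int_inj.
have TP : T @^-1` lpset Q = lpset P.
  apply/seteqP; split=> x; rewrite QE /=; first by move=> [y Py /injT <-].
  by move=> Px; exists x.
have /preserves_area_affine : (a%:~R * d%:~R - b%:~R * c%:~R) ^+ 2 = 1 :> R.
  by rewrite -!intrM -intrB -rmorphXn /= D1.
move=> /(_ e%:~R f%:~R _ (measurable_lpset Q))[_].
rewrite -/(affine_int a b c d e f) -TE TP => h.
by rewrite /vol2 h.
Qed.

Lemma vol2_monotone : monotone_valuation (@vol2 R).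
Proof.
move=> P Q QP; apply: fine_le; rewrite ?mu_lpset_fin//.
by apply: le_measure => //; rewrite inE; exact: measurable_lpset.
Qed.

End Generators.

(** * Cutting valuations along triangles *)

(** This and the next two lemmas check the cone condition of [val_cut] for the three explicit cuts
    made below. *)
Lemma thin_triangle_cone (n : nat) (v := (n.+1%:Z, 0) : int * int) (u := (0, 1) : int * int)
    (w := (n%:Z, 0) : int * int) : 0 < det3 v u w /\
  forall p, p \in [:: (0, 0); w; u] -> [/\ 0 <= det3 v u p, 0 <= det3 w v p & det3 u w p <= 0].
Proof.
split; first by rewrite /det3 /=; lia.
by move=> p; rewrite !inE => /or3P[]/eqP ->; rewrite /det3 /=; split; lia.
Qed.

Lemma parallelogram_cone (u w : int * int) : 0 < det3 (0, 0) u w ->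
  forall p, p \in [:: u; w; (u.1 + w.1, u.2 + w.2)] ->
  [/\ 0 <= det3 (0, 0) u p, 0 <= det3 w (0, 0) p & det3 u w p <= 0].
Proof.
case: u w => [u1 u2] [w1 w2] d0 p.
by rewrite !inE => /or3P[]/eqP ->; move: d0; rewrite /det3 /= => d0; split; lia.
Qed.

Lemma multiple_cone (u w : int * int) (k : nat) : 0 < det3 (0, 0) u w ->
  forall p, p \in [:: u; w; (k.+1%:Z * w.1, k.+1%:Z * w.2)] ->
  [/\ 0 <= det3 (0, 0) u p, 0 <= det3 w (0, 0) p & det3 u w p <= 0].
Proof.
case: u w => [u1 u2] [w1 w2] d0 p.
rewrite !inE => /or3P[]/eqP ->; move: d0; rewrite /det3 /= => d0; split; nia.
Qed.

Section Classification.
Context {R : realType}.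
Variable phi : latticePolytope R -> R.
Hypotheses (vphi : valuation phi) (iphi : lattice_invariant phi).
Implicit Types (s : seq (int * int)) (p u v w : int * int).
Local Notation hull := (@hull R).
Local Notation f s := (phi (poly s)).

Let o : int * int := (0, 0).

Lemma eq_val s1 s2 : hull s1 = hull s2 -> f s1 = f s2.
Proof. by move=> h; congr phi; exact: lpset_inj. Qed.

Lemma val_perm s1 s2 : s1 =i s2 -> f s1 = f s2.
Proof. by move=> h; apply/eq_val/eq_hull. Qed.

Lemma val_cut v u w V : 0 < det3 v u w -> u \in V -> w \in V ->
  (forall p, p \in V -> [/\ 0 <= det3 v u p, 0 <= det3 w v p & det3 u w p <= 0]) ->
  f (v :: V) + f [:: u; w] = f V + f [:: v; u; w].
Proof.
by move=> d0 uV wV cone; apply: vphi.2 => /=; [exact: cut_cup|rewrite cut_cap].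
Qed.

Lemma val_affine (a b c d e g : int) s : (a * d - b * c) ^+ 2 = 1 ->
  f (map (affine_fun a b c d e g) s) = f s.
Proof.
move=> D1; apply: iphi (affine_int_affine a b c d e g) (affine_int_Z2 e g D1) _ _ _.
by rewrite /= affine_hull.
Qed.

Lemma val_translate (q : int * int) s :
  f (map (fun p => (p.1 + q.1, p.2 + q.2)) s) = f s.
Proof.
rewrite -(@val_affine 1 0 0 1 q.1 q.2 s)//; congr (f _); apply: eq_map => p.
by rewrite /affine_fun !mul1r !mul0r addr0 add0r.
Qed.

Lemma val_reflect (q : int * int) s :
  f (map (fun p => (q.1 - p.1, q.2 - p.2)) s) = f s.
Proof.
rewrite -(@val_affine (-1) 0 0 (-1) q.1 q.2 s)//; congr (f _); apply: eq_map => p.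
by rewrite /affine_fun; congr pair; ring.
Qed.

Lemma val_pt p : f [:: p] = f [:: o].
Proof. by rewrite -(val_translate p [:: o]) /= !add0r; case: p. Qed.

(** The split of a segment at (n, 0) is degenerate, out of reach of [val_cut], so union and
    intersection are checked by parameters. *)
Lemma val_segment_step (n : nat) :
  f [:: o; (n.+1%:Z, 0)] + f [:: o] = f [:: o; (n%:Z, 0)] + f [:: o; (1, 0)].
Proof.
have n0 : n.+1%:R != 0 :> R by rewrite pnatr_eq0.
have nE : (n%:R = n.+1%:R - 1 :> R) by rewrite -natr1 addrK.
have e1 : ((n%:Z)%:~R = n%:R :> R) by [].
have e2 : ((n.+1%:Z)%:~R = n.+1%:R :> R) by [].
have n00 : 0 <= n%:R :> R by [].
have fs : f [:: (n%:Z, 0); (n.+1%:Z, 0)] = f [:: o; (1, 0)].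
  by rewrite -(val_translate (n%:Z, 0) [:: o; (1, 0)]).
rewrite -fs -(val_pt (n%:Z, 0)); apply: vphi.2 => /=; last first.
  rewrite hull1; apply/seteqP; split=> [_ ->|].
    by split; apply: mem_hull; rewrite !inE eqxx ?orbT.
  move=> x [/hull2[a /andP[a0 a1] ->] /hull2[b /andP[b0 b1]]].
  rewrite /emb /= ?e1 ?e2 !mulr0 !addr0 => -[ab]; congr pair.
  by rewrite nE in n00 ab *; nra.
apply/seteqP; split; last first.
  have hn : hull [:: o; (n.+1%:Z, 0)] (emb (n%:Z, 0)).
    apply/hull2; exists (n.+1%:R^-1); first by rewrite invr_ge0 ler0n /= invf_le1 ?ler1n ?ltr0n.
    by rewrite /emb /= ?e1 ?e2 !mulr0 !add0r nE; congr pair; field.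
  by move=> x [|]; apply: sub_hull => p; rewrite !inE => /orP[]/eqP -> //;
    apply: mem_hull; rewrite !inE eqxx ?orbT.
move=> x /hull2[t /andP[t0 t1]]; rewrite /emb /= ?e1 ?e2 !mulr0 add0r addr0 => ->.
have [tn|tn] := leP ((1 - t) * n.+1%:R) n%:R.
  left; apply/hull2; rewrite /emb /= ?e1.
  (* For [n = 0] the left piece is a point, and the parameter with denominator [n] makes no
     sense. *)
  have [n00'|n00'] := eqVneq (n%:R : R) 0.
    exists 0; rewrite ?lexx ?ler01// n00' !mulr0 addr0; congr pair.
    by apply/eqP; rewrite eq_le (le_trans tn) ?n00'// mulr_ge0//; lra.
  exists (1 - (1 - t) * n.+1%:R / n%:R).
    have np : 0 < n%:R :> R by rewrite lt_neqAle eq_sym n00' n00.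
    apply/andP; split.
      by rewrite subr_ge0 ler_pdivrMr// mul1r.
    by rewrite gerDl oppr_le0 divr_ge0// mulr_ge0//; lra.
  by rewrite !mulr0 add0r addr0; congr pair; field.
right; apply/hull2; exists (n.+1%:R * t).
  by apply/andP; split; [rewrite mulr_ge0|rewrite nE in tn; lra].
by rewrite /emb /= ?e1 ?e2 !mulr0 addr0 nE; congr pair; ring.
Qed.

Lemma val_segment (n : nat) :
  f [:: o; (n%:Z, 0)] = f [:: o] + n%:R * (f [:: o; (1, 0)] - f [:: o]).
Proof.
elim: n => [|n IH].
  rewrite mul0r addr0; apply: val_perm => p; by rewrite !inE orbb.
by have := val_segment_step n; rewrite IH -natr1; lra.
Qed.

Lemma val_thin_triangle (n : nat) : f [:: o; (n%:Z, 0); (0, 1)] =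
  f [:: o; (1, 0)] + n%:R * (f [:: o; (1, 0); (0, 1)] - f [:: o; (1, 0)]).
Proof.
elim: n => [|n IH].
  rewrite mul0r addr0 -(@val_affine 0 1 1 0 0 0 [:: o; (1, 0)])//=.
  by apply: val_perm => p; rewrite !inE orbA orbb.
(* The chord from (0, 1) to (n, 0) is primitive and the triangle cut off is unimodular, so both have
   standard values. *)
have := @val_cut (n.+1%:Z, 0) (0, 1) (n%:Z, 0) [:: o; (n%:Z, 0); (0, 1)].
have -> : f [:: (0, 1); (n%:Z, 0)] = f [:: o; (1, 0)].
  rewrite -(@val_affine (- n%:Z) (-1) 1 0 n%:Z 0 [:: o; (1, 0)])//=; last first.
    by rewrite mulr0 mulr1 sub0r opprK expr1n.
  have -> : affine_fun (- n%:Z) (-1) 1 0 n%:Z 0 o = (n%:Z, 0).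
    by rewrite /affine_fun /=; congr pair; ring.
  have -> : affine_fun (- n%:Z) (-1) 1 0 n%:Z 0 (1, 0) = (0, 1).
    by rewrite /affine_fun /=; congr pair; ring.
  by apply: val_perm => p; rewrite !inE orbC.
have -> : f [:: (n.+1%:Z, 0); (0, 1); (n%:Z, 0)] = f [:: o; (1, 0); (0, 1)].
  rewrite -(@val_affine 1 (- n%:Z) 0 1 n%:Z 0 [:: o; (1, 0); (0, 1)])//=; last first.
    by rewrite mulr0 subr0 mulr1 expr1n.
  have -> : affine_fun 1 (- n%:Z) 0 1 n%:Z 0 o = (n%:Z, 0).
    by rewrite /affine_fun /=; congr pair; ring.
  have -> : affine_fun 1 (- n%:Z) 0 1 n%:Z 0 (1, 0) = (n.+1%:Z, 0).
    by rewrite /affine_fun /= intS; congr pair; ring.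
  have -> : affine_fun 1 (- n%:Z) 0 1 n%:Z 0 (0, 1) = (0, 1).
    by rewrite /affine_fun /=; congr pair; ring.
  by apply: val_perm => p; rewrite !inE; do 3!case: (p == _).
(* (n, 0) lies on an edge and may be dropped from the generators. *)
have -> : f [:: (n.+1%:Z, 0); o; (n%:Z, 0); (0, 1)] = f [:: o; (n.+1%:Z, 0); (0, 1)].
  apply: eq_val; apply/seteqP; split; apply: sub_hull => p; rewrite !inE; last first.
    by move=> /or3P[]/eqP ->; apply: mem_hull; rewrite !inE eqxx ?orbT.
  move=> /or4P[]/eqP ->; try by apply: mem_hull; rewrite !inE eqxx ?orbT.
  apply: (@hull_mono _ [:: o; (n.+1%:Z, 0)]).
    by move=> q; rewrite !inE => /orP[]/eqP ->; rewrite eqxx ?orbT.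
  apply/hull2; exists (n.+1%:R^-1); first by rewrite invr_ge0 ler0n /= invf_le1 ?ler1n ?ltr0n.
  rewrite /emb /= !mulr0 !add0r; congr pair; rewrite -[(n%:Z)%:~R]/(n%:R) -[(n.+1%:Z)%:~R]/(n.+1%:R).
  have n0 : n.+1%:R != 0 :> R by rewrite pnatr_eq0.
  by have -> : (n%:R = n.+1%:R - 1 :> R); [rewrite -natr1 addrK|field].
rewrite IH -natr1 => h; suff : f [:: o; (n.+1%:Z, 0); (0, 1)] + f [:: o; (1, 0)] =
  f [:: o; (1, 0)] + n%:R * (f [:: o; (1, 0); (0, 1)] - f [:: o; (1, 0)]) +
  f [:: o; (1, 0); (0, 1)] by lra.
have [d0 cone] := thin_triangle_cone n.
by apply: h; rewrite ?inE ?eqxx ?orbT.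
Qed.

(** The reflection x -> u + w - x exchanges the two triangles on either side of the diagonal
    [u w]. *)
Lemma val_parallelogram u w : 0 < det3 o u w ->
  f [:: o; u; w; (u.1 + w.1, u.2 + w.2)] + f [:: u; w] = f [:: o; u; w] *+ 2.
Proof.
move=> d0.
have := val_cut d0 _ _ (parallelogram_cone d0).
have -> : f [:: u; w; (u.1 + w.1, u.2 + w.2)] = f [:: o; u; w].
  rewrite -(val_reflect (u.1 + w.1, u.2 + w.2) [:: o; u; w]) /= !subr0.
  have -> : (u.1 + w.1 - u.1, u.2 + w.2 - u.2) = w.
    by case: (w) => a b /=; congr pair; ring.
  have -> : (u.1 + w.1 - w.1, u.2 + w.2 - w.2) = u.
    by case: (u) => a b /=; congr pair; ring.
  by apply: val_perm => p; rewrite !inE; do 3!case: (p == _).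
by rewrite mulr2n; apply; rewrite ?inE ?eqxx ?orbT.
Qed.
End Classification.

(** * A valuation that is zero on the three standard simplices *)

Section Vanishing.
Context {R : realType}.
Variable phi : latticePolytope R -> R.
Hypotheses (vphi : valuation phi) (iphi : lattice_invariant phi).
Implicit Types (s : seq (int * int)) (p u v w : int * int).
Local Notation hull := (@hull R).
Local Notation f s := (phi (poly s)).
Local Notation o := ((0, 0) : int * int).
Hypotheses (pt0 : f [:: o] = 0) (segment0 : f [:: o; (1, 0)] = 0)
  (triangle0 : f [:: o; (1, 0); (0, 1)] = 0).

(** With g the gcd of the coordinates of q - p, Bezout coefficients complete (q - p) / g to a
    unimodular matrix, which maps the segment from [o] to (g, 0) onto a translate of the given
    one. *)
Let val_segment0 p q : f [:: p; q] = 0.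
Proof.
rewrite -(val_translate iphi (- p.1, - p.2)) /= !subrr.
move: (q.1 - p.1) (q.2 - p.2) => x y {p q}.
have [a xE] := dvdzP (dvdz_gcdl x y); have [b yE] := dvdzP (dvdz_gcdr x y).
have [i [j ij]] := Bezoutz x y.
have [g0|g0] := eqVneq (gcdz x y) 0.
  have x0 : x = 0 by rewrite xE g0 mulr0.
  have y0 : y = 0 by rewrite yE g0 mulr0.
  rewrite x0 y0 (@val_perm _ _ _ [:: o]) ?pt0// => p.
  by rewrite !inE orbb.
have D1 : a * i - (- j) * b = 1.
  apply: (mulIf g0); rewrite mul1r.
  by transitivity (i * (a * gcdz x y) + j * (b * gcdz x y)); [ring|rewrite -xE -yE].
have [n nE] : exists n : nat, gcdz x y = Posz n by exists (gcdn (absz x) (absz y)).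
have h : f [:: o; (Posz n, 0)] = 0.
  by rewrite (val_segment vphi iphi) pt0 segment0 subrr mulr0 addr0.
rewrite -h -(@val_affine _ _ iphi a (- j) b i 0 0 [:: o; (Posz n, 0)]) ?D1//.
by rewrite /= /affine_fun /= !mulr0 !addr0 -nE -xE -yE.
Qed.

Let G u w := f [:: o; u; w].
Let D u w : int := u.1 * w.2 - u.2 * w.1.

Let det3D u w : det3 o u w = D u w.
Proof. by rewrite /det3 /D /= !subr0. Qed.

Let G_swap u w : G u w = G w u.
Proof. by apply: val_perm => p; rewrite !inE; do 3!case: (p == _). Qed.

Let GDr_pos u w : 0 < D u w -> G u (u.1 + w.1, u.2 + w.2) = G u w.
Proof.
move=> d0; have e0 : 0 < det3 o u w by rewrite det3D.
pose z := (u.1 + w.1, u.2 + w.2).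
have := val_parallelogram vphi iphi e0; rewrite val_segment0 addr0 -/z => h1.
(* The same parallelogram, cut along its other diagonal. *)
have h2 : f [:: o; u; w; z] = G u z *+ 2.
  have e1 : 0 < det3 o w (- u.1, - u.2).
    by rewrite det3D; move: d0; congr (_ < _); rewrite /D /=; ring.
  have := val_parallelogram vphi iphi e1; rewrite val_segment0 addr0.
  rewrite -(val_translate iphi u) -[f [:: o; w; _]](val_translate iphi u) /=.
  have -> : (w.1 + - u.1 + u.1, w.2 + - u.2 + u.2) = w.
    by case: (w) => a b /=; rewrite !subrK.
  rewrite !addNr !add0r [w.1 + _]addrC [w.2 + _]addrC -/z -surjective_pairing => h.
  rewrite (@val_perm _ _ _ [:: u; z; o; w]) ?h; last first.
    by move=> p; rewrite !inE; do 4!case: (p == _).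
  by congr (_ *+ 2); apply: val_perm => p; rewrite !inE; do 3!case: (p == _).
by apply: (@mulIf _ 2); rewrite ?pnatr_eq0// !mulr_natr -/z -h2 h1.
Qed.

Let GDr u w : D u w != 0 -> G u (u.1 + w.1, u.2 + w.2) = G u w.
Proof.
rewrite neq_lt => /orP[d0|]; last exact: GDr_pos.
pose z := (u.1 + w.1, u.2 + w.2).
have e : 0 < D w u.
  by move: d0; rewrite -oppr_gt0; congr (_ < _); rewrite /D; ring.
have e' : 0 < D z u.
  by move: e; congr (_ < _); rewrite /D /z /=; ring.
have E1 : G w z = G w u.
  by rewrite -(GDr_pos e); congr (G _ (_, _)); exact: addrC.
(* The reflection of the triangle [o u z] about the midpoint of [o z]. *)
transitivity (G w z); last by rewrite E1 G_swap.
rewrite -/z /G -(val_reflect iphi z [:: o; u; z]) /= !subr0 !subrr.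
have -> : (z.1 - u.1, z.2 - u.2) = w.
  by rewrite /z /=; case: (w) => a b /=; congr pair; ring.
by apply: val_perm => p; rewrite !inE; do 3!case: (p == _).
Qed.

(** Translation by [u] turns the triangle of -u and w into that of u and u + w, so [GDr] applies. *)
Let GN u w : D u w != 0 -> G (- u.1, - u.2) w = G u w.
Proof.
move=> d0; rewrite -(GDr d0) /G -(val_translate iphi u) /= !addNr !add0r.
rewrite ![u.1 + _]addrC ![u.2 + _]addrC -surjective_pairing.
by apply: val_perm => p; rewrite !inE; do 3!case: (p == _).
Qed.

Let GMr_nat u w (k : nat) : D u w != 0 -> G u (w.1 + k%:Z * u.1, w.2 + k%:Z * u.2) = G u w.
Proof.
move=> d0; elim: k => [|k IH]; first by rewrite !mul0r !addr0 -surjective_pairing.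
rewrite -IH -[RHS]GDr.
  by congr (G _ (_, _)); rewrite /= intS; ring.
by move: d0; congr (_ != _); rewrite /D /=; ring.
Qed.

Let GMr u w (k : int) : D u w != 0 -> G u (w.1 + k * u.1, w.2 + k * u.2) = G u w.
Proof.
move=> d0; case: k => [k|k]; first exact: GMr_nat.
rewrite -(@GMr_nat _ (w.1 + Negz k * u.1, w.2 + Negz k * u.2) k.+1).
  by congr (G _ _); case: (w) => a b; rewrite NegzE /=; congr pair; ring.
by move: d0; congr (_ != _); rewrite /D /=; ring.
Qed.

(** The chord [u w] cuts the triangle of u and (k + 2) w into that of u and w and, after translation
    by -w, that of u - w and (k + 1) w. Hence the induction must vary [u]; [GMr] identifies G(u - w,
    w) with G(u, w). *)
Let G_multiple_pos u w (k : nat) : 0 < D u w ->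
  G u (k.+1%:Z * w.1, k.+1%:Z * w.2) = k.+1%:R * G u w.
Proof.
elim: k u => [|k IH] u d0; first by rewrite !mul1r -surjective_pairing.
have e0 : 0 < det3 o u w by rewrite det3D.
have d1 : 0 < D (u.1 - w.1, u.2 - w.2) w.
  by move: d0; congr (_ < _); rewrite /D /=; ring.
have GB : G (u.1 - w.1, u.2 - w.2) w = G u w.
  rewrite G_swap [RHS]G_swap -(@GMr w u (-1)) ?mulN1r//.
  move: d0; rewrite lt0r => /andP[+ _]; rewrite -oppr_eq0; congr (_ != _); rewrite /D; ring.
have := val_cut vphi e0 _ _ (multiple_cone (k := k.+1) e0).
rewrite val_segment0 addr0 -/(G u w).
have -> : f [:: u; w; (k.+2%:Z * w.1, k.+2%:Z * w.2)] =
    G (u.1 - w.1, u.2 - w.2) (k.+1%:Z * w.1, k.+1%:Z * w.2).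
  rewrite -(val_translate iphi (- w.1, - w.2)) /= !subrr.
  have -> : (k.+2%:Z * w.1 - w.1, k.+2%:Z * w.2 - w.2) = (k.+1%:Z * w.1, k.+1%:Z * w.2).
    by rewrite (intS k.+1); congr pair; ring.
  by apply: val_perm => p; rewrite !inE; do 3!case: (p == _).
rewrite IH// GB => h.
rewrite (_ : G u _ = f [:: o; u; w; (k.+2%:Z * w.1, k.+2%:Z * w.2)]); last first.
  apply: eq_val; apply/seteqP; split; apply: sub_hull => p; rewrite !inE.
    by move=> /or3P[]/eqP ->; apply: mem_hull; rewrite !inE eqxx ?orbT.
  move=> /or4P[]/eqP ->; try by apply: mem_hull; rewrite !inE eqxx ?orbT.
  apply: (@hull_mono _ [:: o; (k.+2%:Z * w.1, k.+2%:Z * w.2)]).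
    by move=> q; rewrite !inE => /orP[]/eqP ->; rewrite eqxx ?orbT.
  apply/hull2; exists (1 - k.+2%:R^-1).
    by rewrite subr_ge0 gerBl invf_le1 ?ler1n ?ltr0n// invr_ge0 ler0n.
  have k0 : k.+2%:R != 0 :> R by rewrite pnatr_eq0.
  rewrite /emb /= !intrM !mulr0 !add0r subKr -[(k.+2%:Z)%:~R]/(k.+2%:R).
  by congr pair; field.
rewrite h ?inE ?eqxx ?orbT// -[k.+2%:R]natr1; ring.
Qed.

Let G_multiple0 u w (k : int) : k != 0 -> D u w != 0 -> G u w = 0 ->
  G u (k * w.1, k * w.2) = 0.
Proof.
have pos v (n : nat) : D v w != 0 -> G v w = 0 -> G v (n.+1%:Z * w.1, n.+1%:Z * w.2) = 0.
  rewrite neq_lt => /orP[d0|d0] G0; last by rewrite G_multiple_pos// G0 mulr0.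
  have dN : 0 < D (- v.1, - v.2) w.
    by move: d0; rewrite -oppr_gt0; congr (_ < _); rewrite /D /=; ring.
  rewrite -GN; last first.
    rewrite (_ : D _ _ = n.+1%:Z * D v w); last by rewrite /D /=; ring.
    by rewrite mulf_neq0// lt_eqF.
  by rewrite G_multiple_pos// GN ?G0 ?mulr0// lt_eqF.
case: k => [[|n]|n] // _ d0 G0; first exact: pos.
rewrite G_swap NegzE !mulNr (@GN (n.+1%:Z * w.1, n.+1%:Z * w.2)) ?[G _ u]G_swap; first exact: pos.
rewrite (_ : D _ _ = - n.+1%:Z * D u w); last by rewrite /D /=; ring.
by rewrite mulf_neq0// oppr_eq0.
Qed.

Let G0 u w : D u w != 0 -> G u w = 0.
Proof.
have [n] := ubnP `|u.1|; elim: n u w => // n IH u w un d0.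
have [u10|u10] := eqVneq u.1 0; last first.
  (* Division step and swap: the first argument now starts with [w.1] modulo [u.1]. *)
  rewrite -(@GMr _ w (- (w.1 %/ u.1)%Z))// G_swap; apply: IH => /=.
    have -> : w.1 + - (w.1 %/ u.1)%Z * u.1 = (w.1 %% u.1)%Z by rewrite mulNr.
    have /andP[m0 m1] : (0 <= (w.1 %% u.1)%Z < `|u.1|) by rewrite modz_ge0// ltz_mod.
    by move: un m0 m1; clear; case: (modz _ _) => // m; rewrite -abszE; lia.
  move: d0; rewrite -oppr_eq0; congr (_ != _); rewrite /D /=; ring.
have := d0; rewrite /D u10 mul0r sub0r oppr_eq0 mulf_eq0 negb_or => /andP[u20 w10].
(* End of the algorithm: u = u.2 e2 and [w.1] is nonzero. G(e2, w) reduces to G(e2, w.1 e1) by a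
   column operation, and [G_multiple0] removes the factors [w.1] and [u.2]. *)
have e12 : G (0, 1) (1, 0) = 0 by rewrite G_swap.
have e2w : G (0, 1) w = 0.
  rewrite [w in G _ w]surjective_pairing.
  have := @G_multiple0 (0, 1) (1, 0) w.1 w10 isT e12; rewrite mulr1 mulr0.
  have dw : D (0, 1) (w.1, 0) != 0 by rewrite /D /= mul0r sub0r mul1r oppr_eq0.
  by rewrite -(GMr w.2 dw) /= mulr0 mulr1 add0r addr0.
have -> : u = (u.2 * 0, u.2 * 1) by rewrite mulr0 mulr1 -u10 -surjective_pairing.
rewrite G_swap; apply: (@G_multiple0 w (0, 1) u.2) => //; last by rewrite G_swap.
by rewrite /D /= mulr0 mulr1 subr0.
Qed.

Lemma val_eq0 s : f s = 0.
Proof.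
have [n] := ubnP (size s); elim: n s => // n IH s sn.
have [->|/(@fan_decomposition R)[[u [w /eq_val ->]]|]] := eqVneq s [::].
- by apply: vphi.1; rewrite /= hull0.
- exact: val_segment0.
move=> [v [u [w [V [Vs d0 /andP[uV wV] cone /eq_val ->]]]]].
have := val_cut vphi d0 uV wV cone; rewrite val_segment0 addr0 => ->.
rewrite IH ?add0r; last exact: leq_trans Vs _.
rewrite -(val_translate iphi (- v.1, - v.2)) /= !subrr; apply: G0.
by rewrite /D /=; apply: lt0r_neq0.
Qed.

End Vanishing.

(** * Values on the standard simplices and the cone *)

Section Values.
Context {R : realType}.
Implicit Types (s t : seq (int * int)).
Local Notation hull := (@hull R).
Local Notation mT := (measurableTypeR R).
Local Notation mu := (@lebesgue_measure R \x @lebesgue_measure R)%E.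
Local Notation o := ((0, 0) : int * int).

Lemma euler_char_poly p s : euler_char (poly (p :: s) : latticePolytope R) = 1.
Proof.
rewrite /euler_char (_ : lpset _ != set0)//; apply/set0P; exists (emb p).
by apply: mem_hull; rewrite mem_head.
Qed.

Lemma lattice_count_poly s : uniq s -> (forall p, hull s (emb p) -> p \in s) ->
  lattice_count (poly s : latticePolytope R) = (size s)%:R.
Proof.
move=> us hs; rewrite /lattice_count.
have -> : lpset (poly s) `&` Z2 = (@emb R) @` [set` s].
  apply/seteqP; split=> [x [hx /Z2_emb[p px]]|_ [p ps <-]].
    by exists p; [apply: hs; rewrite -px|exact: esym].
  by split; [exact: mem_hull|apply/Z2_emb; exists p].
rewrite fset_set_image//; last exact: finite_seq.
rewrite card_imfset; last exact: emb_inj.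
congr (_%:R); rewrite (_ : fset_set _ = [fset p in s]%fset); last first.
  by apply/fsetP => p; rewrite in_fset_set ?inE ?mem_setE//; exact: finite_seq.
by rewrite card_fseq undup_id.
Qed.

Let unit_triangle_sub p : hull [:: o; (1, 0); (0, 1)] (emb p) ->
  [/\ 0 <= p.1, 0 <= p.2 & p.1 + p.2 <= 1].
Proof.
have d0 : 0 < det3 o (1, 0) (0, 1) by [].
rewrite hull3// /left_side /= !det3_emb !ler0z /det3 /= => -[[h1 h2] h3].
by move: h1 h2 h3; clear; case: p => a b /=; split; lia.
Qed.

Let unit_segment_sub p : hull [:: o; (1, 0)] (emb p) -> [/\ 0 <= p.1, p.1 <= 1 & p.2 = 0].
Proof.
move=> /hull2[t /andP[t0 t1]]; rewrite /emb /= !mulr0 mulr1 !add0r => -[h1 h2].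
split; first by rewrite -(ler0z R) h1; lra.
  by rewrite -(ler_int R) h1 /=; lra.
by apply/eqP; rewrite -(intr_eq0 R) h2.
Qed.

Lemma lattice_count_pt : lattice_count (poly [:: o] : latticePolytope R) = 1.
Proof.
by apply: lattice_count_poly => // p; rewrite hull1 => /emb_inj ->; rewrite mem_head.
Qed.

Lemma lattice_count_segment : lattice_count (poly [:: o; (1, 0)] : latticePolytope R) = 2.
Proof.
apply: lattice_count_poly => // -[a b] /unit_segment_sub[/= a0 a1 ->].
by rewrite !inE !xpair_eqE /=; lia.
Qed.

Lemma lattice_count_triangle :
  lattice_count (poly [:: o; (1, 0); (0, 1)] : latticePolytope R) = 3.
Proof.
apply: lattice_count_poly => // -[a b] /unit_triangle_sub[/= a0 b0 ab].
by rewrite !inE !xpair_eqE /=; lia.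
Qed.

Lemma vol2_segment : vol2 (poly [:: o; (1, 0)] : latticePolytope R) = 0.
Proof.
pose H : set (mT * mT) := hull [:: o; (1, 0)].
pose I : set mT := `[0, 1]%classic.
pose O : set mT := [set 0].
have : (mu H <= mu (I `*` O))%E.
  apply: le_measure; rewrite ?inE.
  - exact: (measurable_lpset (poly [:: o; (1, 0)])).
  - by apply: measurableX; [exact: measurable_itv|exact: measurable_set1].
  move=> x /hull2[t /andP[t0 t1] ->]; rewrite /emb /= !mulr0 mulr1 !add0r ?addr0.
  by split; [rewrite /I /= in_itv /=; apply/andP; split; lra|rewrite /O /=; lra].
rewrite product_measure1E; [|exact: measurable_itv|exact: measurable_set1].
have O0 : lebesgue_measure O = 0%E by exact: lebesgue_measure_set1.
rewrite [X in (_ <= X)%E](_ : _ = 0%E) => [h|]; last exact: (etrans (congr1 (mule _) O0) (mule0 _)).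
have h0 : mu H = 0%E by apply/eqP; rewrite eq_le h measure_ge0.
by rewrite /vol2 /= -/H h0.
Qed.

Lemma vol2_pt : vol2 (poly [:: o] : latticePolytope R) = 0.
Proof.
apply/eqP; rewrite eq_le -{1}vol2_segment; apply/andP; split; last exact/fine_ge0/measure_ge0.
by apply: vol2_monotone; apply: hull_mono => p; rewrite !inE => ->.
Qed.

Let unit_square : hull [:: o; (1, 0); (0, 1); (1, 1)] =
  `[(0 : R), 1]%classic `*` `[(0 : R), 1]%classic.
Proof.
apply/seteqP; split.
  apply: hull_sub => [x y t t0 t1|p].
    by rewrite /= !in_itv /= => -[/andP[? ?] /andP[? ?]] [/andP[? ?] /andP[? ?]];
      split; apply/andP; split; nra.
  by rewrite !inE => /or4P[]/eqP ->; rewrite /emb /= !in_itv /= ?lexx ?ler01.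
move=> [x y] [/=]; rewrite !in_itv /= => /andP[x0 x1] /andP[y0 y1].
have h p : p \in [:: o; (1, 0); (0, 1); (1, 1)] -> hull [:: o; (1, 0); (0, 1); (1, 1)] (emb p).
  exact: mem_hull.
(* [h1] and [h2] are the points of the bottom and top edges at abscissa [x]; the point sought is
   between them. *)
have h1 := hull_convex x0 x1 (h (1, 0) isT) (h o isT).
have h2 := hull_convex x0 x1 (h (1, 1) isT) (h (0, 1) isT).
have := hull_convex y0 y1 h2 h1; congr (hull _ (_, _)); rewrite /emb /=; ring.
Qed.

(** No integral is computed: [val_parallelogram], applied to [vol2] itself, halves the unit square
    along a diagonal of area 0. *)
Lemma vol2_triangle : vol2 (poly [:: o; (1, 0); (0, 1)] : latticePolytope R) = 2^-1.
Proof.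
have := @val_parallelogram R vol2 vol2_valuation vol2_invariant (1, 0) (0, 1) isT.
have -> : vol2 (poly [:: (1, 0); (0, 1)] : latticePolytope R) = 0.
  rewrite -vol2_segment -(@val_affine R vol2 vol2_invariant (-1) (-1) 1 0 1 0 [:: o; (1, 0)])//.
have -> : vol2 (poly [:: o; (1, 0); (0, 1); (1 + 0, 0 + 1)] : latticePolytope R) = 1.
  rewrite /vol2 /= unit_square; set I : set mT := `[0, 1]%classic.
  have mI : measurable I by exact: measurable_itv.
  have I1 : lebesgue_measure I = 1%E.
    by rewrite lebesgue_measure_itv /= lte_fin ltr01 oppr0 adde0.
  rewrite product_measure1E//.
  exact: (congr1 fine (etrans (congr2 mule I1 I1) (mule1 _))).
lra.
Qed.

End Values.

(** * Coordinates of a valuation and their signs *)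

Section Cone.
Context {R : realType}.
Implicit Types (phi psi : latticePolytope R -> R).
Local Notation o := ((0, 0) : int * int).

(** The shape [k *: phi + psi] treats sums and multiples at once, so a nested combination is handled
    by iteration. *)
Lemma valuation_linear k phi psi : valuation phi -> valuation psi -> valuation (k *: phi + psi).
Proof.
move=> [p0 pU] [q0 qU]; split=> [P P0|P Q U I UE IE].
  by rewrite /= !fctE p0// q0// scaler0 addr0.
rewrite !fctE /GRing.scale /=; have := pU _ _ _ _ UE IE; have := qU _ _ _ _ UE IE; nra.
Qed.

Lemma lattice_invariant_linear k phi psi :
  lattice_invariant phi -> lattice_invariant psi -> lattice_invariant (k *: phi + psi).
Proof. by move=> hp hq T aT TZ P Q QE; rewrite !fctE (hp T aT TZ P) ?(hq T aT TZ P). Qed.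

Lemma monotone_valuation_linear k phi psi : 0 <= k ->
  monotone_valuation phi -> monotone_valuation psi -> monotone_valuation (k *: phi + psi).
Proof.
move=> k0 hp hq P Q QP; rewrite !fctE; apply: lerD; last exact: hq.
by rewrite /GRing.scale /=; apply: ler_wpM2l => //; exact: hp.
Qed.

Lemma b_vol2E : b_val + vol2 = (-1) *: euler_char + lattice_count :> (latticePolytope R -> R).
Proof. by apply/funext => P; rewrite !fctE /b_val /GRing.scale /=; ring. Qed.

Lemma b_vol2_valuation : valuation (b_val + vol2 : latticePolytope R -> R).
Proof.
rewrite b_vol2E.
by apply: valuation_linear; [exact: euler_char_valuation|exact: lattice_count_valuation].
Qed.

Lemma b_vol2_invariant : lattice_invariant (b_val + vol2 : latticePolytope R -> R).
Proof.
rewrite b_vol2E.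
by apply: lattice_invariant_linear; [exact: euler_char_invariant|exact: lattice_count_invariant].
Qed.

Lemma b_vol2_monotone : monotone_valuation (b_val + vol2 : latticePolytope R -> R).
Proof.
rewrite b_vol2E => P Q QP; rewrite !fctE /GRing.scale /= /euler_char.
(* Subtracting the Euler characteristic matters only when passing from the empty set to a nonempty
   polytope, and there a vertex supplies the lattice point that compensates. *)
have [Q0|Q0] := eqVneq (lpset Q) set0.
  rewrite (lattice_count_valuation.1 Q Q0) mulr0 addr0.
  have [P0|P0] := eqVneq (lpset P) set0; first by rewrite mulr0 add0r; exact: ler0n.
  rewrite mulN1r addrC subr_ge0.
  have [[|p s] PE] := polyP P; first by move: P0; rewrite PE /= hull0 eqxx.
  rewrite -(euler_char_poly p [::]) -[X in _ <= X]/(lattice_count P) (euler_char_poly p [::]).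
  have -> : 1 = lattice_count (poly [:: o] : latticePolytope R) by rewrite lattice_count_pt.
  rewrite -(@val_pt _ _ lattice_count_invariant p); apply: lattice_count_monotone.
  by rewrite PE; apply: hull_mono => q; rewrite !inE => ->.
have -> : lpset P != set0.
  by have /set0P[x /QP Px] := Q0; apply/set0P; exists x.
by rewrite lerD2l; exact: lattice_count_monotone.
Qed.

Lemma b_vol2_pt : (b_val + vol2) (poly [:: o] : latticePolytope R) = 0.
Proof. by rewrite b_vol2E !fctE euler_char_poly lattice_count_pt /GRing.scale /=; ring. Qed.

Lemma b_vol2_segment : (b_val + vol2) (poly [:: o; (1, 0)] : latticePolytope R) = 1.
Proof. by rewrite b_vol2E !fctE euler_char_poly lattice_count_segment /GRing.scale /=; ring. Qed.

Lemma b_vol2_triangle : (b_val + vol2) (poly [:: o; (1, 0); (0, 1)] : latticePolytope R) = 2.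
Proof. by rewrite b_vol2E !fctE euler_char_poly lattice_count_triangle /GRing.scale /=; ring. Qed.

(** On the point, the segment and the triangle the generators take the values (1, 1, 1), (0, 1, 2)
    and (0, 0, 1/2); solving this triangular system gives the coefficients. *)
Lemma valuation_basis phi : valuation phi -> lattice_invariant phi ->
  let a := phi (poly [:: o]) in let b := phi (poly [:: o; (1, 0)]) in
  let c := phi (poly [:: o; (1, 0); (0, 1)]) in
  phi = a *: euler_char + (b - a) *: (b_val + vol2) + (2 * (c - 2 * b + a)) *: vol2.
Proof.
move=> vp ip a b c; apply/funext => P; have [s ->] := polyP P.
pose psi : latticePolytope R -> R := (- a) *: euler_char +
  ((a - b) *: (b_val + vol2) + ((- (2 * (c - 2 * b + a))) *: vol2 + phi)).
have vpsi : valuation psi.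
  apply: valuation_linear; first exact: euler_char_valuation.
  apply: valuation_linear; first exact: b_vol2_valuation.
  by apply: valuation_linear; first exact: vol2_valuation.
have ipsi : lattice_invariant psi.
  apply: lattice_invariant_linear; first exact: euler_char_invariant.
  apply: lattice_invariant_linear; first exact: b_vol2_invariant.
  by apply: lattice_invariant_linear; first exact: vol2_invariant.
have psiE P' : psi P' = - a * euler_char P' + ((a - b) * (b_val + vol2) P' +
  (- (2 * (c - 2 * b + a)) * vol2 P' + phi P')) by [].
have h : psi (poly s) = 0.
  apply: val_eq0 => //; rewrite psiE euler_char_poly.
  - by rewrite b_vol2_pt vol2_pt -/a; ring.
  - by rewrite b_vol2_segment vol2_segment -/b; ring.
  - by rewrite b_vol2_triangle vol2_triangle -/c; field.
move: h; rewrite psiE => h.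
change (phi (poly s) = a * euler_char (poly s) + (b - a) * (b_val + vol2) (poly s) +
  2 * (c - 2 * b + a) * vol2 (poly s)).
lra.
Qed.

Lemma monotone_coefficients phi : valuation phi -> lattice_invariant phi -> monotone_valuation phi ->
  exists a b' c : R, [/\ 0 <= a, 0 <= b', 0 <= c &
    phi = a *: euler_char + b' *: (b_val + vol2) + c *: vol2].
Proof.
move=> vp ip mp.
exists (phi (poly [:: o])), (phi (poly [:: o; (1, 0)]) - phi (poly [:: o])),
  (2 * (phi (poly [:: o; (1, 0); (0, 1)]) - 2 * phi (poly [:: o; (1, 0)]) + phi (poly [:: o]))).
split; last exact: valuation_basis.
- rewrite -(vp.1 (poly [::])); last exact: hull0.
  by apply: mp => /=; rewrite hull0.
- by rewrite subr_ge0; apply: mp; apply: hull_mono => p; rewrite !inE => ->.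
set a := phi (poly [:: o]); set b := phi (poly [:: o; (1, 0)]).
set c := phi _.
(* The segment [o, (n, 0)] is an edge of the triangle [o, (n, 0), (0, 1)]. *)
have key (n : nat) : 0 <= b - a + n%:R * (c - 2 * b + a).
  have : phi (poly [:: o; (n%:Z, 0)]) <= phi (poly [:: o; (n%:Z, 0); (0, 1)]).
    by apply: mp; apply: hull_mono => p; rewrite !inE => /orP[]->; rewrite ?orbT.
  by rewrite val_segment// val_thin_triangle// -/a -/b -/c; lra.
rewrite mulr_ge0//; rewrite leNgt; apply/negP => d0.
(* For a negative slope, [key] fails at every [n] beyond this zero of the affine function. *)
pose x := (b - a) / - (c - 2 * b + a).
have x0 : 0 <= x.
  apply: divr_ge0; last by rewrite oppr_ge0 ltW.
  by have := key 0; rewrite mul0r addr0.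
have := key (Num.bound x); have := archi_boundP x0.
rewrite /x ltr_pdivrMr ?oppr_gt0//; lra.
Qed.

End Cone.

Theorem theorem7p6 (R : realType) :
  (forall phi : latticePolytope R -> R,
     valuation phi -> lattice_invariant phi ->
     (monotone_valuation phi <->
      exists a b' c : R, [/\ 0 <= a, 0 <= b', 0 <= c &
        phi = a *: euler_char + b' *: (b_val + vol2) + c *: vol2])) /\
  simplicial_cone_generated_by
    [set phi : latticePolytope R -> R |
       [/\ valuation phi, lattice_invariant phi & monotone_valuation phi]]
    [tuple (euler_char : latticePolytope R -> R); b_val + vol2; vol2].
Proof.
have conic (a b c : R) : 0 <= a -> 0 <= b -> 0 <= c ->
    let phi : latticePolytope R -> R := a *: euler_char + b *: (b_val + vol2) + c *: vol2 in
    [/\ valuation phi, lattice_invariant phi & monotone_valuation phi].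
  move=> a0 b0 c0 phi.
  (* The trailing zero valuation gives the innermost term the shape [k *: phi + psi]. *)
  have -> : phi = a *: euler_char + (b *: (b_val + vol2) + (c *: vol2 + 0)).
    by rewrite /phi addr0 addrA.
  split.
  - apply: valuation_linear; first exact: euler_char_valuation.
    apply: valuation_linear; first exact: b_vol2_valuation.
    by apply: valuation_linear; [exact: vol2_valuation|split].
  - apply: lattice_invariant_linear; first exact: euler_char_invariant.
    apply: lattice_invariant_linear; first exact: b_vol2_invariant.
    by apply: lattice_invariant_linear; first exact: vol2_invariant.
  - apply: monotone_valuation_linear => //; first exact: euler_char_monotone.
    apply: monotone_valuation_linear => //; first exact: b_vol2_monotone.
    by apply: monotone_valuation_linear => //; first exact: vol2_monotone.
split=> [phi vp ip|].
  split=> [mp|[a [b [c [a0 b0 c0 ->]]]]]; first exact: monotone_coefficients.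
  by case: (conic a b c a0 b0 c0).
split.
  move=> c; rewrite !big_ord_recl big_ord0 addr0 => c0.
  set c1 := c ord0 in c0; set c2 := c (lift ord0 ord0) in c0.
  set c3 := c (lift ord0 (lift ord0 ord0)) in c0.
  have cE (P : latticePolytope R) : c1 * euler_char P + (c2 * (b_val + vol2) P + c3 * vol2 P) = 0.
    exact: (congr1 (fun g => g P) c0).
  (* Evaluation at the three standard simplices gives a triangular system with diagonal 1, 1,
     1/2. *)
  have := cE (poly [:: (0, 0)]); rewrite euler_char_poly b_vol2_pt vol2_pt => h1.
  have := cE (poly [:: (0, 0); (1, 0)]); rewrite euler_char_poly b_vol2_segment vol2_segment => h2.
  have := cE (poly [:: (0, 0); (1, 0); (0, 1)]).
  rewrite euler_char_poly b_vol2_triangle vol2_triangle => h3.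
  have e1 : c1 = 0 by lra.
  have e2 : c2 = 0 by lra.
  have e3 : c3 = 0 by lra.
  by move=> [[|[|[|//]]] i3];
    [rewrite -[RHS]e1|rewrite -[RHS]e2|rewrite -[RHS]e3]; congr c; exact: val_inj.
apply/seteqP; split=> phi.
  move=> [vp ip mp]; have [a [b [c [a0 b0 c0 E]]]] := monotone_coefficients vp ip mp.
  exists (tnth [tuple a; b; c]).
    by move=> [[|[|[|//]]] i3]; rewrite (tnth_nth 0).
  by rewrite !big_ord_recl big_ord0 addr0 addrA.
move=> [c c0 ->]; rewrite !big_ord_recl big_ord0 addr0 addrA.
exact: conic.
Qed.
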